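(* Let $X\in B_{\mathbb{K}\mathbb{R}^n_\bot}$ be fixed, where $X$ is a (non-empty) finite union of hyperboxes with rational coordinates. Then the functionals $$\operatorname{max_V}(\cdot,X):(\mathbb{I}\mathbb{R}^n_\bot\Rightarrow\mathbb{I}\mathbb{R}^1_\bot)\to\mathbb{I}\mathbb{R}^1_\bot\quad\text{and}\quad \operatorname{max_S}(\cdot,X):(\mathbb{I}\mathbb{R}^n_\bot\Rightarrow\mathbb{I}\mathbb{R}^1_\bot)\to\mathbb{K}\mathbb{R}^n_\bot$$ are computable.
   Context: Domains: $\mathbb{K}\mathbb{R}^n_\bot$ is the set of non-empty compact subsets of $\mathbb{R}^n$ together with $\bot=\mathbb{R}^n$, and $\mathbb{I}\mathbb{R}^n_\bot$ is the set of hyperboxes $\prod_{i=1}^n[a_i,b_i]$ together with $\bot=\mathbb{R}^n$, both ordered by reverse inclusion ($X\sqsubseteq Y\iff Y\subseteq X$). $D\Rightarrow E$ is the set of Scott-continuous maps $D\to E$ ordered pointwise. Write $x\ll y$ (way-below) iff for every directed set $A$ with $y\sqsubseteq\bigsqcup A$ there is $d\in A$ with $x\sqsubseteq d$; in $\mathbb{K}\mathbb{R}^n_\bot$ and $\mathbb{I}\mathbb{R}^n_\bot$, $K_1\ll K_2$ iff $K_2\subseteq K_1^\circ$ (interior). Bases: $B_{\mathbb{I}\mathbb{R}^n_\bot}$ consists of $\mathbb{R}^n$ and all hyperboxes with rational coordinates. $B_{\mathbb{K}\mathbb{R}^n_\bot}$ consists of $\mathbb{R}^n$ and all non-empty finite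 unions of hyperboxes with rational coordinates. For $d\in\mathbb{I}\mathbb{R}^n_\bot$ and $e\in\mathbb{I}\mathbb{R}^1_\bot$, the single-step function $e\chi_{\twoheaduparrow d}$ maps $x$ to $e$ if $d\ll x$ and to $\bot$ otherwise. The basis of $\mathbb{I}\mathbb{R}^n_\bot\Rightarrow\mathbb{I}\mathbb{R}^1_\bot$ consists of the rational step functions, i.e. suprema of finite sets, bounded above, of single-step functions $e\chi_{\twoheaduparrow d}$ with $d\in B_{\mathbb{I}\mathbb{R}^n_\bot}$ and $e\in B_{\mathbb{I}\mathbb{R}^1_\bot}$. These countable bases are enumerated effectively in the standard way, with bottom as element number $0$. Computability: let $D,E$ be $\omega$-continuous domains with enumerated bases $\{d_0,d_1,\dots\}$ and $\{e_0,e_1,\dots\}$, effectively given (the way-below relation on basis indices is recursively enumerable). A map $F:D\to E$ is computable iff $\{(i,j)\in\mathbb{N}\times\mathbb{N}\mid e_i\ll F(d_j)\}$ is recursively enumerable. Functionals: writing $f(x)=f(\{x\})=[\underline{f(x)},\overline{f(x)}]$ (with endpoints $\mp\infty$ if $f(x)=\bot$), $\operatorname{max_V}(f,X)=[\underline z,\overline z]$ with $\underline z=\sup_{x\in X}\underline{f(x)}$ and $\overline z=\sup_{x\in X}\overline{f(x)}$ (read as $\bot$ if $\overline z=+\infty$), and $\operatorname{max_S}(f,X)=\{x\in X\mid f(x)\cap[\underline z,\overline z]\ne\emptyset\}$, the intersection being tested in the extended real line (so $x\in\operatorname{max_S}(f,X)$ iff $\overline{f(x)}\ge\underline z$). *)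

(* Defs.v *)
From HB Require Import structures.
From mathcomp Require Import all_boot all_order all_algebra.
From mathcomp Require Import all_classical all_reals all_analysis.
Set Implicit Arguments.
Unset Strict Implicit.
Unset Printing Implicit Defensive.
Import Order.TTheory GRing.Theory Num.Theory.
Import numFieldNormedType.Exports.
Local Open Scope classical_set_scope.
Local Open Scope ring_scope.

Inductive recfun : nat -> Type :=
| rec_zero k : recfun k
| rec_succ : recfun 1
| rec_proj k : 'I_k -> recfun k
| rec_comp m k : recfun m -> ('I_m -> recfun k) -> recfun k
| rec_prim k : recfun k -> recfun k.+2 -> recfun k.+1
| rec_mu k : recfun k.+1 -> recfun k.

(** [rec_eval c x y] : the function coded by [c] is defined at [x], with value
    [y].  In [rec_prim], the recursion variable comes first, and the step
    function receives the counter, the previous value and the parameters. *)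
Fixpoint rec_eval k (c : recfun k) : k.-tuple nat -> nat -> Prop :=
  match c in recfun k return k.-tuple nat -> nat -> Prop with
  | rec_zero _ => fun _ y => y = 0%N
  | rec_succ => fun x y => y = (thead x).+1
  | rec_proj _ i => fun x y => y = tnth x i
  | rec_comp m _ g h => fun x y => exists z : m.-tuple nat,
      (forall i, rec_eval (h i) x (tnth z i)) /\ rec_eval g z y
  | rec_prim _ f g => fun x y => exists s : nat -> nat,
      [/\ rec_eval f (behead_tuple x) (s 0%N),
          forall t, (t < thead x)%N ->
            rec_eval g [tuple of t :: s t :: behead_tuple x] (s t.+1)
        & y = s (thead x)]
  | rec_mu _ f => fun x y =>
      rec_eval f [tuple of y :: x] 0%N /\
      forall t, (t < y)%N -> exists v, rec_eval f [tuple of t :: x] v.+1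
  end.

Definition recursively_enumerable (S : set (nat * nat)) :=
  exists c : recfun 2,
    forall i j, S (i, j) <-> exists y, rec_eval c [tuple i; j] y.

Section Domains.
Context {dD dE : Order.disp_t} {D : porderType dD} {E : porderType dE}.

Definition directed (A : set D) :=
  A !=set0 /\
  forall x y, A x -> A y -> exists z, [/\ A z, (x <= z)%O & (y <= z)%O].

Definition way_below (x y : D) :=
  forall (A : set D) (s : D), directed A -> supremums A s -> (y <= s)%O ->
    exists2 a, A a & (x <= a)%O.

Definition scott_continuous (f : D -> E) :=
  forall (A : set D) (s : D), directed A -> supremums A s ->
    supremums (f @` A) (f s).

End Domains.

Record scott_map {dD dE : Order.disp_t} (D : porderType dD) (E : porderType dE)
  := ScottMap { scott_fun :> D -> E ; scottP : scott_continuous scott_fun }.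

Section ScottMapOrder.
Context {dD dE : Order.disp_t} {D : porderType dD} {E : porderType dE}.
Implicit Types f g : scott_map D E.

Lemma scott_map_eq f g : scott_fun f = scott_fun g -> f = g.
Proof.
case: f g => [f fP] [g gP] /= fg; rewrite -{}fg in gP *.
by rewrite (Prop_irrelevance fP gP).
Qed.

Definition scott_le f g : bool := `[< forall x, (f x <= g x)%O >].

Lemma scott_le_refl : reflexive scott_le.
Proof. by move=> f; apply/asboolP. Qed.

Lemma scott_le_anti : antisymmetric scott_le.
Proof.
move=> f g /andP[/asboolP fg /asboolP gf]; apply/scott_map_eq/funext => x.
by apply/le_anti; rewrite fg gf.
Qed.

Lemma scott_le_trans : transitive scott_le.
Proof.
move=> g f h /asboolP fg /asboolP gh; apply/asboolP => x.
exact: le_trans (fg x) (gh x).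
Qed.

End ScottMapOrder.

Fact scott_display : Order.disp_t. Proof. exact: Order.Disp tt tt. Qed.

HB.instance Definition _ dD dE (D : porderType dD) (E : porderType dE) :=
  gen_eqMixin (scott_map D E).
HB.instance Definition _ dD dE (D : porderType dD) (E : porderType dE) :=
  gen_choiceMixin (scott_map D E).
HB.instance Definition _ dD dE (D : porderType dD) (E : porderType dE) :=
  Order.Le_isPOrder.Build scott_display (scott_map D E)
    (@scott_le_refl _ _ D E) (@scott_le_anti _ _ D E)
    (@scott_le_trans _ _ D E).

Section Monotone.
Context {dD dE : Order.disp_t} {D : porderType dD} {E : porderType dE}.

Lemma scott_mono (f : D -> E) : scott_continuous f ->
  forall x y, (x <= y)%O -> (f x <= f y)%O.
Proof.
move=> fc x y xy.
have /fc : directed [set z | z = x \/ z = y].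
  split; first by exists x; left.
  by move=> _ _ [->|->] [->|->]; exists y; split=> //; right.
move=> /(_ y)[]; last by move=> + _; apply; exists x => //; left.
split=> [_ [->|->] //|z]; apply; by right.
Qed.

Lemma directed_image (f : D -> E) A : scott_continuous f -> directed A ->
  directed (f @` A).
Proof.
move=> fc [[a Aa] dA]; split; first by exists (f a), a.
move=> _ _ [x Ax <-] [y Ay <-]; have [z [Az xz yz]] := dA _ _ Ax Ay.
by exists (f z); split; [exists z | exact: scott_mono | exact: scott_mono].
Qed.

Lemma scott_const (e : E) : scott_continuous (fun _ : D => e).
Proof.
move=> A s [[a Aa] _] _; split=> [_ [x _ <-] //|c]; by apply; exists a.
Qed.

End Monotone.

Definition computable {dD dE : Order.disp_t} {D : porderType dD}
    {E : porderType dE} (d : nat -> D) (e : nat -> E) (F : D -> E) :=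
  recursively_enumerable [set ij | way_below (e ij.1) (F (d ij.2))].

Definition box {R : realType} {n} (a b : 'rV[R]_n) : set 'rV[R]_n :=
  [set x | forall i, a ord0 i <= x ord0 i <= b ord0 i].

Definition hyperbox {R : realType} {n} (B : set 'rV[R]_n) :=
  exists a b : 'rV[R]_n, (forall i, a ord0 i <= b ord0 i) /\ B = box a b.

Record IR (R : realType) (n : nat) := MkIR {
  IR_set :> set 'rV[R]_n ;
  IRP : IR_set = setT \/ hyperbox IR_set }.

Record compacts (R : realType) (n : nat) := MkCompacts {
  compacts_set :> set 'rV[R]_n ;
  compactsP : compacts_set !=set0 /\ compact compacts_set }.

Record KR (R : realType) (n : nat) := MkKR {
  KR_set :> set 'rV[R]_n ;
  KRP : KR_set = setT \/ (KR_set !=set0 /\ compact KR_set) }.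

Section Orders.
Context {R : realType} {n : nat}.

Lemma IR_eq (B C : IR R n) : IR_set B = IR_set C -> B = C.
Proof.
case: B C => [B BP] [C CP] /= BC; rewrite -{}BC in CP *.
by rewrite (Prop_irrelevance BP CP).
Qed.

Lemma KR_eq (B C : KR R n) : KR_set B = KR_set C -> B = C.
Proof.
case: B C => [B BP] [C CP] /= BC; rewrite -{}BC in CP *.
by rewrite (Prop_irrelevance BP CP).
Qed.

Definition IR_le (B C : IR R n) : bool := `[< IR_set C `<=` IR_set B >].
Definition KR_le (B C : KR R n) : bool := `[< KR_set C `<=` KR_set B >].

Lemma IR_le_refl : reflexive IR_le.
Proof. by move=> B; apply/asboolP. Qed.

Lemma IR_le_anti : antisymmetric IR_le.
Proof. by move=> B C /andP[/asboolP CB /asboolP BC]; apply/IR_eq/seteqP. Qed.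

Lemma IR_le_trans : transitive IR_le.
Proof.
by move=> C B A /asboolP h1 /asboolP h2; apply/asboolP; exact: subset_trans h1.
Qed.

Lemma KR_le_refl : reflexive KR_le.
Proof. by move=> B; apply/asboolP. Qed.

Lemma KR_le_anti : antisymmetric KR_le.
Proof. by move=> B C /andP[/asboolP CB /asboolP BC]; apply/KR_eq/seteqP. Qed.

Lemma KR_le_trans : transitive KR_le.
Proof.
by move=> C B A /asboolP h1 /asboolP h2; apply/asboolP; exact: subset_trans h1.
Qed.

End Orders.

Fact revincl_display : Order.disp_t. Proof. exact: Order.Disp tt tt. Qed.

HB.instance Definition _ R n := gen_eqMixin (IR R n).
HB.instance Definition _ R n := gen_choiceMixin (IR R n).
HB.instance Definition _ R n := Order.Le_isPOrder.Build revincl_display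
  (IR R n) (@IR_le_refl R n) (@IR_le_anti R n) (@IR_le_trans R n).
HB.instance Definition _ R n := gen_eqMixin (KR R n).
HB.instance Definition _ R n := gen_choiceMixin (KR R n).
HB.instance Definition _ R n := Order.Le_isPOrder.Build revincl_display
  (KR R n) (@KR_le_refl R n) (@KR_le_anti R n) (@KR_le_trans R n).

Section Elements.
Context {R : realType} {n : nat}.
Implicit Types (a b x : 'rV[R]_n) (B C : IR R n).

Lemma IR_leP B C : (B <= C)%O <-> IR_set C `<=` IR_set B.
Proof. by split => [/asboolP|?]; [| apply/asboolP]. Qed.

Lemma KR_leP (B C : KR R n) : (B <= C)%O <-> KR_set C `<=` KR_set B.
Proof. by split => [/asboolP|?]; [| apply/asboolP]. Qed.

Definition IR_bot : IR R n := MkIR (or_introl erefl).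
Definition KR_bot : KR R n := MkKR (or_introl erefl).

Lemma IR_bot_le B : (IR_bot <= B)%O.
Proof. exact/IR_leP. Qed.

Lemma hyperbox_box a b : (forall i, a ord0 i <= b ord0 i) -> hyperbox (box a b).
Proof. by move=> ab; exists a, b. Qed.

Definition IR_box a b (ab : forall i, a ord0 i <= b ord0 i) : IR R n :=
  MkIR (or_intror (hyperbox_box ab)).

Definition IR_pt x : IR R n := IR_box (fun i => lexx (x ord0 i)).

Lemma IR_ptE x : IR_set (IR_pt x) = [set x].
Proof.
apply/seteqP; split=> [y /= yx|_ -> i]; last by rewrite lexx.
by apply/rowP => i; apply/le_anti; rewrite andbC; exact: yx.
Qed.

Lemma IR_pt_le B x : (B <= IR_pt x)%O <-> IR_set B x.
Proof.
split=> [/IR_leP|Bx]; first by rewrite IR_ptE; apply.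
by apply/IR_leP; rewrite IR_ptE => _ ->.
Qed.

Lemma box_compact a b : compact (box a b).
Proof.
exact: (@rV_compact R n (fun i => `[a ord0 i, b ord0 i]%classic)
  (fun i => @segment_compact _ _ _)).
Qed.

Lemma box_closed a b : closed (box a b).
Proof. by apply: compact_closed => //; exact: box_compact. Qed.

Lemma IR_nonempty B : IR_set B !=set0.
Proof.
case: B => B /= [->|[a [b [ab ->]]]]; first by exists 0.
by exists a => i; rewrite lexx ab.
Qed.

Lemma IR_closed B : closed (IR_set B).
Proof.
case: B => B /= [->|[a [b [ab ->]]]]; [exact: closedT|exact: box_closed].
Qed.

Lemma IR_sup_sub (A : set (IR R n)) (s : IR R n) (U : set 'rV[R]_n) :
  directed A -> supremums A s -> open U -> IR_set s `<=` U ->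
  exists2 B, A B & IR_set B `<=` U.
Proof.
move=> [[B0 AB0] dA] [ubs lubs] oU sU; apply: contrapT => noB.
have nsub B : A B -> (IR_set B `\` U) !=set0.
  move=> AB; apply: contrapT => BU; apply: noB; exists B => // x Bx.
  by apply: contrapT => Ux; apply: BU; exists x.
have [B1 AB1 cB1] : exists2 B, A B & compact (IR_set B).
  apply: contrapT => nocpt.
  have AT B : A B -> B = IR_bot.
    move=> AB; apply: IR_eq => /=; have [//|[a [b [ab E]]]] := IRP B.
    by case: nocpt; exists B => //; rewrite E; exact: box_compact.
  have sT : (s <= IR_bot)%O by apply: lubs => B /AT ->.
  have [x [_]] := nsub _ AB0; apply; apply: sU.
  by move/IR_leP : sT; apply.
pose F := filter_from A (fun B => IR_set B `\` U).
have FF : ProperFilter F.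
  apply: filter_from_proper => //; apply: filter_from_filter; first by exists B0.
  move=> B C AB AC; have [D [AD /IR_leP DB /IR_leP DC]] := dA _ _ AB AC.
  by exists D => // x [Dx Ux]; split; split=> //; [exact: DB|exact: DC].
have [|x [B1x Fx]] := cB1 F FF; first by exists B1 => // x [].
have clx B : A B -> (IR_set B `\` U) x.
  move=> AB; have cl : closed (IR_set B `\` U).
    by apply: closedI; [exact: IR_closed|exact: open_closedC].
  by apply: cl => N Nx; apply: Fx => //; exists B.
have /IR_pt_le sx : (s <= IR_pt x)%O.
  by apply: lubs => B AB; apply/IR_pt_le; have [] := clx B AB.
by have [_] := clx _ AB0; apply; exact: sU.
Qed.

Definition thicken a b (e : R) :=
  box (\row_i (a ord0 i - e)) (\row_i (b ord0 i + e)).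

Definition thickenings a b : set (IR R n) :=
  [set B | exists2 e : R, 0 < e & IR_set B = thicken a b e].

Lemma thicken_IR a b (e : R) : (forall i, a ord0 i <= b ord0 i) -> 0 < e ->
  exists2 B : IR R n, thickenings a b B & IR_set B = thicken a b e.
Proof.
move=> ab e0.
have h i : (\row_i (a ord0 i - e)) ord0 i <= (\row_i (b ord0 i + e)) ord0 i.
  by rewrite !mxE lerD // (le_trans _ (ltW e0)) // oppr_le0 ltW.
by exists (IR_box h) => //; exists e.
Qed.

Lemma thicken_sub a b (e e' : R) : e <= e' -> thicken a b e `<=` thicken a b e'.
Proof.
move=> ee' x xe i; have := xe i; rewrite !mxE => /andP[h1 h2]; apply/andP; split.
  by apply: le_trans h1; rewrite lerB.
by apply: (le_trans h2); rewrite lerD2l.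
Qed.

Lemma thickenings_directed a b : (forall i, a ord0 i <= b ord0 i) ->
  directed (thickenings a b).
Proof.
move=> ab; split; first by have [B ? _] := thicken_IR ab (@ltr01 R); exists B.
move=> B C [e e0 Be] [e' e'0 Ce'].
have m0 : 0 < Num.min e e' by rewrite lt_min e0 e'0.
have [D tD De] := thicken_IR ab m0; exists D; split=> //; apply/IR_leP.
  by rewrite De Be; apply: thicken_sub; rewrite ge_min lexx.
by rewrite De Ce'; apply: thicken_sub; rewrite ge_min lexx orbT.
Qed.

Lemma thickenings_sup a b (B : IR R n) : (forall i, a ord0 i <= b ord0 i) ->
  IR_set B = box a b -> supremums (thickenings a b) B.
Proof.
move=> ab BE; split=> [C [e e0 CE]|C ubC].
  apply/IR_leP; rewrite BE CE => x xab i; rewrite !mxE.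
  have /andP[h1 h2] := xab i; apply/andP; split.
    by rewrite lerBlDr (le_trans h1)// lerDl ltW.
  by rewrite (le_trans h2)// lerDl ltW.
apply/IR_leP; rewrite BE => x Cx i.
have {}Cx e : 0 < e -> thicken a b e x.
  move=> e0; have [D tD <-] := thicken_IR ab e0.
  by have /IR_leP := ubC D tD; apply.
by apply/andP; split; apply/ler_addgt0Pr => e /Cx /(_ i); rewrite !mxE => /andP[];
  rewrite ?lerBlDr.
Qed.

Lemma ball_thicken a b x y (e : R) : box a b x -> ball x e y -> thicken a b e y.
Proof.
move=> xab [_ xy] i; have /andP[h1 h2] := xab i; rewrite !mxE.
have := xy ord0 i; rewrite /ball /= ltr_distlC => /andP[h3 h4].
apply/andP; split.
  by apply: le_trans (ltW h3); rewrite lerB.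
by apply: (le_trans (ltW h4)); rewrite lerD.
Qed.

Lemma IR_way_belowP (B C : IR R n) :
  way_below B C <-> IR_set C `<=` (IR_set B)°.
Proof.
split=> [BC|CB A s dA As /IR_leP Cs]; last first.
  have [|D AD Dsub] := IR_sup_sub dA As (@open_interior _ (IR_set B)).
    exact: subset_trans CB.
  exists D => //; apply/IR_leP; apply: subset_trans Dsub _.
  exact: interior_subset.
have [CT|[a [b [ab CE]]]] := IRP C.
  have dbot : directed [set IR_bot].
    by split=> [|x y -> ->]; [exists IR_bot | exists IR_bot].
  have sbot : supremums [set IR_bot] IR_bot by rewrite supremums1.
  have Cbot : (C <= IR_bot)%O by apply/IR_leP; rewrite CT.
  have [_ -> /IR_leP BT] := BC _ _ dbot sbot Cbot.
  have -> : IR_set B = setT by apply/seteqP; split.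
  by rewrite interiorT.
have [D [e e0 DE] /IR_leP DB] :=
  BC _ _ (thickenings_directed ab) (thickenings_sup ab CE) (lexx _).
move=> x Cx; apply/nbhs_ballP; exists e => // y xy.
by apply: DB; rewrite DE; apply: ball_thicken xy; rewrite -CE.
Qed.

Lemma IR_way_below_sup (B : IR R n) (A : set (IR R n)) (s : IR R n) :
  directed A -> supremums A s -> way_below B s ->
  exists2 C, A C & way_below B C.
Proof.
move=> dA As /IR_way_belowP Bs.
have [C AC CB] := IR_sup_sub dA As (@open_interior _ (IR_set B)) Bs.
by exists C => //; apply/IR_way_belowP.
Qed.

Lemma IR_way_below_mono (B C D : IR R n) :
  way_below B C -> (C <= D)%O -> way_below B D.
Proof. by move=> BC CD A s dA As Ds; apply: BC (le_trans CD Ds). Qed.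

End Elements.

Arguments IR_bot {R n}.
Arguments KR_bot {R n}.

Section SingleStep.
Context {R : realType} {n : nat}.
Implicit Types (d : IR R n) (e : IR R 1).

Definition step_fun d e (x : IR R n) : IR R 1 :=
  if pselect (way_below d x) then e else IR_bot.

Lemma step_scott d e : scott_continuous (step_fun d e).
Proof.
move=> A s dA As; rewrite /step_fun; split=> [_ [x Ax <-]|c ubc].
  case: pselect => dx; last exact: IR_bot_le.
  case: pselect => //= ds; case: ds.
  by apply: IR_way_below_mono dx _; exact: As.1.
case: pselect => ds; last exact: IR_bot_le.
have [a Aa da] := IR_way_below_sup dA As ds.
by apply: ubc; exists a => //; case: pselect.
Qed.

Definition single_step d e : scott_map (IR R n) (IR R 1) :=
  ScottMap (@step_scott d e).

Definition scott_bot : scott_map (IR R n) (IR R 1) :=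
  ScottMap (scott_const (IR_bot : IR R 1)).

End SingleStep.

Section Functionals.
Context {R : realType} {n : nat}.
Local Notation "D ==> E" := (scott_map D E) (at level 55).
Implicit Types (f : IR R n ==> IR R 1) (X : compacts R n).
Local Open Scope ereal_scope.

(** Endpoints of an element of [IR R 1]; those of the bottom element are
    [-oo] and [+oo]. *)
Definition lower (B : IR R 1) : \bar R :=
  ereal_inf [set (y ord0 ord0)%:E | y in IR_set B].
Definition upper (B : IR R 1) : \bar R :=
  ereal_sup [set (y ord0 ord0)%:E | y in IR_set B].

Definition max_lower f X : \bar R :=
  ereal_sup [set lower (f (IR_pt x)) | x in compacts_set X].
Definition max_upper f X : \bar R :=
  ereal_sup [set upper (f (IR_pt x)) | x in compacts_set X].

Definition maxV_set X f : set 'rV[R]_1 :=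
  if max_upper f X == +oo then setT
  else [set y | max_lower f X <= (y ord0 ord0)%:E <= max_upper f X].

(** The intervals below are intervals of the extended real line. *)
Definition maxS_set X f : set 'rV[R]_n :=
  [set x | compacts_set X x /\
    (`[lower (f (IR_pt x)), upper (f (IR_pt x))] `&`
     `[max_lower f X, max_upper f X]) !=set0].

Lemma IR1_cases (B : IR R 1) :
  [/\ IR_set B = setT, lower B = -oo & upper B = +oo] \/
  exists l u : R, [/\ (l <= u)%R,
    IR_set B = [set y | (l <= y ord0 ord0 <= u)%R],
    lower B = l%:E & upper B = u%:E].
Proof.
have [BT|[a [b [ab BE]]]] := IRP B; [left|right].
  have im : [set (y ord0 ord0)%:E | y in IR_set B] = [set r%:E | r in [set: R]].
    rewrite BT; apply/seteqP; split=> [_ [y _ <-]|_ [r _ <-]].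
      by exists (y ord0 ord0).
    by exists (const_mx r) => //; rewrite mxE.
  split=> //; rewrite /lower /upper im.
    apply/eqP; rewrite -leeNy_eq leNgt; apply/negP.
    case E : (ereal_inf _) => [r| |]//.
    - move=> _; have : ereal_inf [set r%:E | r in [set: R]] <= (r - 1)%:E.
        by apply: ereal_inf_lbound; exists (r - 1)%R.
      by rewrite E lee_fin lerBrDr gerDl ler10.
    - move=> _; have : ereal_inf [set r%:E | r in [set: R]] <= 0%:E.
        by apply: ereal_inf_lbound; exists 0%R.
      by rewrite E.
  apply/eqP; rewrite -leye_eq leNgt; apply/negP.
  case E : (ereal_sup _) => [r| |]//.
  - move=> _; have : (r + 1)%:E <= ereal_sup [set r%:E | r in [set: R]].
      by apply: ereal_sup_ubound; exists (r + 1)%R.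
    by rewrite E lee_fin gerDl ler10.
  - move=> _; have : 0%:E <= ereal_sup [set r%:E | r in [set: R]].
      by apply: ereal_sup_ubound; exists 0%R.
    by rewrite E.
have BE' : IR_set B = [set y | (a ord0 ord0 <= y ord0 ord0 <= b ord0 ord0)%R].
  rewrite BE; apply/seteqP; split=> [y /(_ ord0)//|y /= yab i].
  by rewrite (ord1 i).
exists (a ord0 ord0), (b ord0 ord0); split=> //; apply/le_anti/andP; split.
- by apply: ereal_inf_lbound; exists a => //; rewrite BE' /= lexx ab.
- by apply: le_ereal_inf_tmp => _ [y + <-]; rewrite BE' lee_fin => /andP[].
- by apply: ge_ereal_sup => _ [y + <-]; rewrite BE' lee_fin => /andP[].
- by apply: ereal_sup_ubound; exists b => //; rewrite BE' /= lexx ab.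
Qed.

Lemma lower_le_upper (B : IR R 1) : lower B <= upper B.
Proof.
have [[_ -> ->]|[l [u [lu _ -> ->]]]] := IR1_cases B; first exact: leNye.
by rewrite lee_fin.
Qed.

Lemma upper_mono (B C : IR R 1) : (B <= C)%O -> upper C <= upper B.
Proof.
by move=> /IR_leP CB; apply/ereal_sup_le/image_subset.
Qed.

Lemma max_lowerP f X x : compacts_set X x ->
  lower (f (IR_pt x)) <= max_lower f X.
Proof. by move=> Xx; apply: ereal_sup_ubound; exists x. Qed.

Lemma max_upperP f X x : compacts_set X x ->
  upper (f (IR_pt x)) <= max_upper f X.
Proof. by move=> Xx; apply: ereal_sup_ubound; exists x. Qed.

Lemma max_lower_le_upper f X : max_lower f X <= max_upper f X.
Proof.
apply: ge_ereal_sup => _ [x Xx <-].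
exact: le_trans (lower_le_upper _) (max_upperP _ Xx).
Qed.

Lemma maxV_subproof X f : maxV_set X f = setT \/ hyperbox (maxV_set X f).
Proof.
rewrite /maxV_set; case: eqP => [_|/eqP hT]; [by left|right].
have [[x0 Xx0] _] := compactsP X.
have := max_upperP f Xx0; have := max_lowerP f Xx0.
have [[_ _ ->]|[l [u [_ _ -> ->]]]] := IR1_cases (f (IR_pt x0)).
  by rewrite leye_eq (negbTE hT).
have := max_lower_le_upper f X; move: hT.
case: (max_upper f X) => [z| |]//.
case: (max_lower f X) => [w| |]//.
move=> _ wz _ _; exists (const_mx w), (const_mx z); split.
  by move=> i; rewrite !mxE -lee_fin.
apply/seteqP; split=> y /=.
  by rewrite !lee_fin => + i; rewrite !mxE (ord1 i).
by move=> /(_ ord0); rewrite !mxE !lee_fin.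
Qed.

Definition maxV X f : IR R 1 := MkIR (@maxV_subproof X f).

Lemma maxS_setE X f :
  maxS_set X f = compacts_set X `&` [set x | max_lower f X <= upper (f (IR_pt x))].
Proof.
apply/seteqP; split=> x /= [Xx].
  move=> [y []]; rewrite /= !in_itv /= => /andP[_ yu] /andP[zy _].
  by split=> //; exact: le_trans yu.
move=> zu; split=> //; exists (max_lower f X); split; rewrite /= in_itv /=.
  by rewrite zu (max_lowerP _ Xx).
by rewrite lexx max_lower_le_upper.
Qed.

Lemma upper_usc f (c : \bar R) : open [set x | upper (f (IR_pt x)) < c].
Proof.
rewrite openE => x /= xc.
have [r xr rc] : exists2 r : R, upper (f (IR_pt x)) < r%:E & r%:E <= c.
  have [[_ _ E]|[l [u [_ _ _ E]]]] := IR1_cases (f (IR_pt x)).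
    by move: xc; rewrite E ltNge leey.
  rewrite E in xc *; case: c xc => [c| |] xc //.
    by exists c.
  by exists (u + 1)%R => //; rewrite ?leey // lte_fin ltrDl.
have xx i : (x ord0 i <= x ord0 i)%R by exact: lexx.
pose A := thickenings x x.
have dA : directed A by exact: thickenings_directed.
have sA : supremums A (IR_pt x) by exact: thickenings_sup.
have dfA := directed_image (@scottP _ _ _ _ f) dA.
have sfA := @scottP _ _ _ _ f _ _ dA sA.
pose U := [set y : 'rV[R]_1 | (y ord0 ord0 < r)%R].
have oU : open U.
  apply: (@open_comp _ _ (fun y : 'rV[R]_1 => y ord0 ord0) [set t | (t < r)%R]).
    by move=> y _; exact: coord_continuous.
  exact: open_lt.
have fU : IR_set (f (IR_pt x)) `<=` U.
  move=> y fy; rewrite /U /= -lte_fin; apply: le_lt_trans xr.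
  by apply: ereal_sup_ubound; exists y.
have [_ [B [e e0 BE] <-] fBU] := IR_sup_sub dfA sfA oU fU.
apply/nbhs_ballP; exists e => // y xy /=.
have yB : (B <= IR_pt y)%O.
  apply/IR_pt_le; rewrite BE; apply: ball_thicken xy => i.
  by rewrite lexx.
apply: le_lt_trans (upper_mono (scott_mono (@scottP _ _ _ _ f) yB)) _.
apply: lt_le_trans rc.
have [[E _ _]|[l [u [lu E _ ->]]]] := IR1_cases (f B).
  by have := fBU (const_mx r); rewrite E /U /= mxE ltxx => /(_ I).
rewrite lte_fin; have := fBU (const_mx u); rewrite E /U /= mxE; apply.
by rewrite lu lexx.
Qed.

Lemma maxS_subproof X f :
  maxS_set X f = setT \/ (maxS_set X f !=set0 /\ compact (maxS_set X f)).
Proof.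
right; have [[x0 Xx0] cX] := compactsP X.
have cl c : closed [set x | c <= upper (f (IR_pt x))].
  rewrite (_ : [set x | _] = ~` [set x | upper (f (IR_pt x)) < c]).
    by apply: open_closedC; exact: upper_usc.
  by apply/seteqP; split=> x /=; rewrite leNgt => /negP.
rewrite maxS_setE; split; last first.
  apply: (subclosed_compact _ cX); last by move=> ? [].
  by apply: closedI; [exact: compact_closed | exact: cl].
pose G x := compacts_set X `&`
  [set y | lower (f (IR_pt x)) <= upper (f (IR_pt y))].
have FF : ProperFilter (filter_from (compacts_set X) G).
  apply: filter_from_proper; last first.
    by move=> x Xx; exists x; split=> //; exact: lower_le_upper.
  apply: filter_from_filter; first by exists x0.
  move=> x y Xx Xy.
  have [xy|/ltW yx] := leP (lower (f (IR_pt x))) (lower (f (IR_pt y))).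
    by exists y => // z [Xz h]; split; split=> //=; exact: le_trans h.
  by exists x => // z [Xz h]; split; split=> //=; exact: le_trans h.
have [|y [Xy clust]] := cX _ FF; first by exists x0 => // z [].
exists y; split=> //=; apply: ge_ereal_sup => _ [x Xx <-].
apply: (cl (lower (f (IR_pt x)))) => N Ny; apply: clust => //.
by exists x => // z [].
Qed.

Definition maxS X f : KR R n := MkKR (@maxS_subproof X f).

End Functionals.

Section Bases.
Context {R : realType}.

Definition rat_hyperbox {n} (B : set 'rV[R]_n) :=
  exists a b : 'rV[rat]_n, (forall i, a ord0 i <= b ord0 i) /\
    B = box (map_mx ratr a) (map_mx ratr b).

Definition rat_box_union {n} (K : set 'rV[R]_n) :=
  exists m (B : 'I_m.+1 -> set 'rV[R]_n),
    (forall i, rat_hyperbox (B i)) /\ K = \bigcup_i B i.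

Definition B_IR {n} : set (IR R n) :=
  [set B | IR_set B = setT \/ rat_hyperbox (IR_set B)].

Definition B_KR {n} : set (KR R n) :=
  [set K | KR_set K = setT \/ rat_box_union (KR_set K)].

Definition B_fun {n} : set (scott_map (IR R n) (IR R 1)) :=
  [set g | exists m (d : 'I_m -> IR R n) (e : 'I_m -> IR R 1),
    [/\ forall i, B_IR (d i), forall i, B_IR (e i)
      & supremums (range (fun i => single_step (d i) (e i))) g]].

(** Finite sequences of numbers are coded by the bijection
    [CodeSeq.decode : nat -> seq nat], with [CodeSeq.decode 0 = [::]]. *)

Definition rat_enum (k : nat) : rat :=
  let l := CodeSeq.decode k in
  ((nth 0%N l 0)%:R - (nth 0%N l 1)%:R) / (nth 0%N l 2).+1%:R.

Definition rat_point n (k : nat) : 'rV[rat]_n :=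
  \row_(i < n) rat_enum (nth 0%N (CodeSeq.decode k) i).

(** Corners of the box spanned by the two rational points coded by [k]. *)
Definition corner_min n (k : nat) : 'rV[rat]_n :=
  let l := CodeSeq.decode k in
  \row_(i < n) Num.min (rat_point n (nth 0%N l 0) ord0 i)
                       (rat_point n (nth 0%N l 1) ord0 i).
Definition corner_max n (k : nat) : 'rV[rat]_n :=
  let l := CodeSeq.decode k in
  \row_(i < n) Num.max (rat_point n (nth 0%N l 0) ord0 i)
                       (rat_point n (nth 0%N l 1) ord0 i).

Lemma corner_le n k i : corner_min n k ord0 i <= corner_max n k ord0 i.
Proof. by rewrite !mxE ge_min le_max lexx. Qed.

Lemma ratr_corner_le n k i :
  map_mx (ratr : rat -> R) (corner_min n k) ord0 i <=
  map_mx (ratr : rat -> R) (corner_max n k) ord0 i.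
Proof. by rewrite mxE [leRHS]mxE ler_rat corner_le. Qed.

Definition rat_box n (k : nat) : IR R n := IR_box (@ratr_corner_le n k).

Definition IR_enum n (j : nat) : IR R n :=
  if j is k.+1 then rat_box n k else IR_bot.

Definition KR_enum_set n (j : nat) : set 'rV[R]_n :=
  let l := CodeSeq.decode j in
  if l is [::] then setT else \bigcup_(k in [set` l]) IR_set (rat_box n k).

Lemma KR_enum_subproof n j : @KR_enum_set n j = setT \/
  (@KR_enum_set n j !=set0 /\ compact (@KR_enum_set n j)).
Proof.
rewrite /KR_enum_set; case: (CodeSeq.decode j) => [|k l]; [by left|right].
split.
  have [x kx] := IR_nonempty (rat_box n k).
  by exists x; exists k => //=; rewrite inE eqxx.
rewrite bigcup_seq; elim: (k :: l) => [|h t IH].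
  by rewrite big_nil; exact: compact0.
by rewrite big_cons; apply: compactU => //; exact: box_compact.
Qed.

Definition KR_enum n (j : nat) : KR R n := MkKR (@KR_enum_subproof n j).

Definition single_step_enum n (p : nat) : scott_map (IR R n) (IR R 1) :=
  let l := CodeSeq.decode p in
  single_step (IR_enum n (nth 0%N l 0)) (IR_enum 1 (nth 0%N l 1)).

(** [supremum] returns its default value, here the bottom element, on the empty
    set and on sets without supremum, that is (see [bounded_steps_sup]) on the
    finite sets of single-step functions that are not bounded above. *)
Definition fun_enum n (j : nat) : scott_map (IR R n) (IR R 1) :=
  supremum scott_bot
    [set single_step_enum n p | p in [set` CodeSeq.decode j]].

Lemma IR1_sup (S : set (IR R 1)) (c : IR R 1) : ubound S c ->
  supremums S !=set0.
Proof.
move=> ubc; have [y0 cy0] := IR_nonempty c.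
have IR1E (B : IR R 1) y :
    IR_set B y <-> (lower B <= (y ord0 ord0)%:E <= upper B)%E.
  have [[-> -> ->]|[l [u [_ -> -> ->]]]] := IR1_cases B.
    by rewrite leNye leey.
  by rewrite /= !lee_fin.
have [Sbot|[B0 SB0 [l0 [u0 [lE uE]]]]] : (forall B, S B -> B = IR_bot) \/
    exists2 B, S B & exists l u : R, lower B = l%:E /\ upper B = u%:E.
  apply: contrapT => /not_orP[h1 h2]; apply: h1 => B SB; apply: IR_eq => /=.
  have [[-> _ _]//|[l [u [_ _ lE uE]]]] := IR1_cases B.
  by case: h2; exists B => //; exists l, u.
  exists IR_bot; split=> [B /Sbot ->//|b ubb]; exact: IR_bot_le.
pose l := ereal_sup [set lower B | B in S].
pose u := ereal_inf [set upper B | B in S].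
have ly0 : (l <= (y0 ord0 ord0)%:E)%E.
  apply: ge_ereal_sup => _ [B SB <-].
  by have /IR_leP/(_ _ cy0)/IR1E/andP[] := ubc B SB.
have uy0 : ((y0 ord0 ord0)%:E <= u)%E.
  apply: le_ereal_inf_tmp => _ [B SB <-].
  by have /IR_leP/(_ _ cy0)/IR1E/andP[] := ubc B SB.
have ll0 : (l0%:E <= l)%E by rewrite -lE; apply: ereal_sup_ubound; exists B0.
have uu0 : (u <= u0%:E)%E by rewrite -uE; apply: ereal_inf_lbound; exists B0.
have lfin : l \is a fin_num.
  by rewrite fin_real// (lt_le_trans (ltNyr l0) ll0) (le_lt_trans ly0)// ltry.
have ufin : u \is a fin_num.
  by rewrite fin_real// (lt_le_trans (ltNyr _) uy0) (le_lt_trans uu0)// ltry.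
have lu (i : 'I_1) : (const_mx (fine l) : 'rV[R]_1) ord0 i <=
    (const_mx (fine u) : 'rV[R]_1) ord0 i.
  by rewrite !mxE -lee_fin !fineK// (le_trans ly0 uy0).
have sE y : IR_set (IR_box lu) y <-> (l <= (y ord0 ord0)%:E <= u)%E.
  have -> t : (l <= t%:E <= u)%E = (fine l <= t <= fine u).
    by rewrite -!lee_fin !fineK.
  split=> [/(_ ord0)|h i].
    by rewrite !mxE.
  by rewrite !mxE (ord1 i).
exists (IR_box lu); split=> [B SB|b ubb]; apply/IR_leP => y.
  move=> /sE/andP[h1 h2]; apply/IR1E/andP; split.
    by apply: le_trans h1; apply: ereal_sup_ubound; exists B.
  by apply: (le_trans h2); apply: ereal_inf_lbound; exists B.
move=> by_; apply/sE/andP; split.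
  apply: ge_ereal_sup => _ [B SB <-].
  by have /IR_leP/(_ _ by_)/IR1E/andP[] := ubb B SB.
apply: le_ereal_inf_tmp => _ [B SB <-].
by have /IR_leP/(_ _ by_)/IR1E/andP[] := ubb B SB.
Qed.

Lemma bounded_steps_sup n (S : set (scott_map (IR R n) (IR R 1))) :
  ubound S !=set0 -> supremums S !=set0.
Proof.
move=> [h ubh]; pose V x := [set scott_fun f x | f in S].
have /choice[g gP] x : exists s, supremums (V x) s.
  by apply: (@IR1_sup _ (h x)) => _ [f Sf <-]; have /asboolP := ubh f Sf; apply.
have gs : scott_continuous g.
  move=> A s dA As; split=> [_ [x Ax <-]|c ubc].
    apply: (gP x).2 => _ [f Sf <-]; apply: (@le_trans _ _ (f s)).
      by apply: (scott_mono (@scottP _ _ _ _ f)); exact: As.1.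
    by apply: (gP s).1; exists f.
  apply: (gP s).2 => _ [f Sf <-].
  have [_] := @scottP _ _ _ _ f _ _ dA As; apply => _ [x Ax <-].
  apply: (@le_trans _ _ (g x)); first by apply: (gP x).1; exists f.
  by apply: ubc; exists x.
exists (ScottMap gs); split=> [f Sf|k ubk]; apply/asboolP => x /=.
  by apply: (gP x).1; exists f.
by apply: (gP x).2 => _ [f Sf <-]; have /asboolP := ubk f Sf; apply.
Qed.

Lemma rat_enum_surj (r : rat) : exists k, rat_enum k = r.
Proof.
pose a := `|numq r|%N; pose d := `|denq r|%N.-1.
have dE : (d.+1%:R : rat) = (denq r)%:~R.
  have d0 : (0 < `|denq r|)%N by rewrite absz_gt0 denq_neq0.
  by rewrite prednK// -[in RHS](gtz0_abs (denq_gt0 r)).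
have [n0|n0] := leP 0 (numq r).
  exists (CodeSeq.code [:: a; 0; d]%N); rewrite /rat_enum CodeSeq.codeK /= dE.
  by rewrite subr0 -[RHS]divq_num_den -[in RHS](gez0_abs n0).
exists (CodeSeq.code [:: 0; a; d]%N); rewrite /rat_enum CodeSeq.codeK /= dE.
rewrite sub0r -[RHS]divq_num_den; congr (_ / _).
by rewrite -[numq r in RHS]opprK -[in RHS](ltz0_abs n0) rmorphN.
Qed.

Lemma code_ord m (g : 'I_m -> nat) : exists k,
  size (CodeSeq.decode k) = m /\
  forall i : 'I_m, nth 0%N (CodeSeq.decode k) i = g i.
Proof.
exists (CodeSeq.code [seq g i | i <- enum 'I_m]); rewrite CodeSeq.codeK.
split; first by rewrite size_map size_enum_ord.
by move=> i; rewrite (nth_map i) ?size_enum_ord// nth_ord_enum.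
Qed.

Lemma rat_point_surj n (v : 'rV[rat]_n) : exists k, rat_point n k = v.
Proof.
have /choice[g gP] : forall i, exists k, rat_enum k = v ord0 i.
  by move=> i; exact: rat_enum_surj.
have [k [_ kP]] := code_ord g; exists k.
by apply/rowP => i; rewrite mxE kP gP.
Qed.

Lemma rat_box_surj n (B : set 'rV[R]_n) :
  rat_hyperbox B <-> exists k, IR_set (rat_box n k) = B.
Proof.
split=> [[a [b [ab ->]]]|[k <-]]; last first.
  by exists (corner_min n k), (corner_max n k); split=> // i; exact: corner_le.
have [p pa] := rat_point_surj a; have [q qb] := rat_point_surj b.
pose k := CodeSeq.code [:: p; q]; exists k.
have ka : corner_min n k = a.
  apply/rowP => i; rewrite /corner_min CodeSeq.codeK /= mxE pa qb.
  by apply/min_idPl; exact: ab.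
have kb : corner_max n k = b.
  apply/rowP => i; rewrite /corner_max CodeSeq.codeK /= mxE pa qb.
  by apply/max_idPr; exact: ab.
by rewrite -ka -kb.
Qed.

Lemma range_IR_enum n : range (IR_enum n) = B_IR.
Proof.
apply/seteqP; split=> [_ [[|k] _ <-]|B /= [BT|/rat_box_surj[k kB]]].
- by left.
- by right; apply/rat_box_surj; exists k.
- by exists 0%N => //; apply: IR_eq.
- by exists k.+1 => //; apply: IR_eq.
Qed.

Lemma range_KR_enum n : range (KR_enum n) = B_KR.
Proof.
apply/seteqP; split=> [_ [j _ <-]|K /= [KT|[m [B [/= Brat KE]]]]].
- rewrite /B_KR /= /KR_enum_set; case: (CodeSeq.decode j) => [|k l]; [by left|].
  right; exists (size l), (fun i => IR_set (rat_box n (nth 0%N (k :: l) i))).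
  split=> [i|]; first by apply/rat_box_surj; eexists.
  apply/seteqP; split=> x.
    move=> [p /= pl xp].
    have hp : (index p (k :: l) < size (k :: l))%N by rewrite index_mem.
    exists (Ordinal hp) => //.
    by rewrite (_ : nth _ _ _ = p)//; exact: nth_index.
  move=> [i _ xi]; exists (nth 0%N (k :: l) i) => //=.
  by apply: mem_nth; exact: ltn_ord.
- by exists 0%N => //; apply: KR_eq.
- have /choice[g gP] : forall i, exists k, IR_set (rat_box n k) = B i.
    by move=> i; apply/rat_box_surj.
  have [j [sz jP]] := code_ord g.
  exists j => //; apply: KR_eq; rewrite /= KE /KR_enum_set.
  have -> : forall T (a b : T),
      (if CodeSeq.decode j is [::] then a else b) = b.
    by move=> T a b; case: (CodeSeq.decode j) sz.
  apply/seteqP; split=> x.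
    move=> [p /= /(nthP 0%N)[i]]; rewrite sz => im <- xi.
    by exists (Ordinal im) => //; rewrite -gP -jP.
  move=> [i _ xi]; exists (g i); last by rewrite gP.
  by rewrite /= -jP mem_nth// sz.
Qed.

Lemma supremum_botE n (S : set (scott_map (IR R n) (IR R 1))) g :
  supremums S g -> supremum scott_bot S = g.
Proof.
move=> Sg; rewrite /supremum; case: eqP => [S0|_].
  apply/le_anti/andP; split; last by apply: Sg.2; rewrite S0 => f.
  by apply/asboolP => x; exact: IR_bot_le.
by case: xgetP => [h _ Sh|/(_ g)//]; apply: is_subset1_supremums Sh Sg.
Qed.

Lemma range_fun_enum n : range (fun_enum n) = B_fun.
Proof.
have IRB k m : B_IR (IR_enum m k) by rewrite -range_IR_enum; exists k.
apply/seteqP; split=> [_ [j _ <-]|g [m [d [e [dB eB gsup]]]]].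
  have [[g gsup]|noS] := pselect (supremums
      [set single_step_enum n p | p in [set` CodeSeq.decode j]] !=set0).
    rewrite /fun_enum (supremum_botE gsup).
    pose l := CodeSeq.decode j; pose c i := CodeSeq.decode (nth 0%N l i).
    exists (size l), (fun i => IR_enum n (nth 0%N (c i) 0)),
      (fun i => IR_enum 1 (nth 0%N (c i) 1)); split=> //.
    rewrite [X in supremums X _](_ : _ =
      [set single_step_enum n p | p in [set` CodeSeq.decode j]])//.
    apply/seteqP; split=> [_ [i _ <-]|_ [p /= /(nthP 0%N)[i il <-] <-]].
      by exists (nth 0%N l i) => //=; rewrite mem_nth.
    by exists (Ordinal il).
  have -> : fun_enum n j = scott_bot.
    rewrite /fun_enum /supremum; case: ifP => // _.
    by case: xgetP => // h _ Sh; case: noS; exists h.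
  exists 0%N, (fun _ => IR_bot), (fun _ => IR_bot); split=> [[]//|[]//|].
  split=> [_ [[]]//|b _]; apply/asboolP => x; exact: IR_bot_le.
have /choice[u uP] : forall i, exists k, IR_enum n k = d i.
  by move=> i; have := dB i; rewrite -range_IR_enum => -[k _ <-]; exists k.
have /choice[v vP] : forall i, exists k, IR_enum 1 k = e i.
  by move=> i; have := eB i; rewrite -range_IR_enum => -[k _ <-]; exists k.
pose c i := CodeSeq.code [:: u i; v i]; have [j [sz jP]] := code_ord c.
have stepE i : single_step_enum n (CodeSeq.code [:: u i; v i]) =
    single_step (d i) (e i).
  by rewrite /single_step_enum CodeSeq.codeK /= uP vP.
exists j => //; apply: supremum_botE.
rewrite [X in supremums X _](_ : _ = range (fun i => single_step (d i) (e i)))//.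
apply/seteqP; split=> [y [p /= /(nthP 0%N)[i]]|_ [i _ <-]].
  rewrite sz => im <- <-; exists (Ordinal im) => //.
  by rewrite -stepE -[CodeSeq.code _]/(c _) -jP.
exists (c i); last exact: stepE.
by rewrite /= -jP mem_nth// sz.
Qed.

End Bases.

(* Main.v *)
Require Import Defs.
From mathcomp Require Import all_boot all_order all_algebra.
From mathcomp Require Import all_classical all_reals all_analysis.
From mathcomp Require Import lra.

(** For a finite step function [f], given by steps [e_p] on the interiors of
    boxes [d_p], the value at a point [x] is the intersection of the [e_p] with
    [x] in the interior of [d_p].  Hence [upper (f x) < c] iff some such [e_p]
    has [upper e_p < c], and dually for [lower], so that the way-below relations
    in question become first-order statements about points of [R^n] and finitely
    many rational boxes.  Such statements are constant on the cells of the grid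
    of all coordinate values involved; whether [x] is interior to a union of
    boxes is decided by the cells whose closure contains [x].  It therefore
    suffices to test finitely many rational points, one in each cell; a bound on
    the codes of enough test points is found by unbounded search. *)

(** Searching for the bound keeps the arithmetic small: comparison of coded rationals is all that
    must be shown recursive, and midpoints occur only in the proof that the search ends. An entry of
    a code is at most the code, and box endpoints are picked among nested entries, so the grid of
    all rationals with codes up to [i + j + kX] contains every relevant coordinate without any being
    extracted. Two points need care. A list of steps without upper bound enumerates the bottom
    function, so boundedness is decided too: at every point the active intervals must have a common
    element. And a strict bound on the values at the points of [X] must survive the supremum over
    [X], which it does because only finitely many steps occur. *)

Set Implicit Arguments.
Unset Strict Implicit.
Unset Printing Implicit Defensive.
Import Order.TTheory GRing.Theory Num.Theory.
Import numFieldNormedType.Exports.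
Local Open Scope classical_set_scope.

(** * Recursive functions *)

(** [e] presents a context [A] as the argument tuple of a code; bound variables
    extend the context by [push]. *)
Definition total_rec A k (e : A -> k.-tuple nat) (f : A -> nat) :=
  exists c : recfun k, forall a y, rec_eval c (e a) y <-> y = f a.

Local Notation cb e b := (total_rec e (fun a => nat_of_bool (b a))).

Definition push A k (e : A -> k.-tuple nat) (z : A * nat) : k.+1.-tuple nat :=
  [tuple of z.2 :: e z.1].

Section Closure.
Context {A : Type} {k : nat} {e : A -> k.-tuple nat}.
Implicit Types (f g : A -> nat) (b : A -> bool).

Local Notation cf := (total_rec e).
Local Notation cb b := (total_rec e (fun a => nat_of_bool (b a))).

(** Composition of codes, stated as a change of environment; weakening and primitive recursion are
    derived from it. *)
Lemma rec_env m (u : A -> m.-tuple nat) f :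
  (forall i, cf (fun a => tnth (u a) i)) -> total_rec u f -> cf f.
Proof.
move=> /choice[c cP] [d dP]; exists (rec_comp d c) => a y /=; split.
  move=> [z [zP]]; rewrite (_ : z = u a) => [/dP //|].
  by apply/eq_from_tnth => i; apply/cP.
by move=> yE; exists (u a); split=> [i|]; [apply/cP|apply/dP].
Qed.

Lemma rec_tnth i : cf (fun a => tnth (e a) i).
Proof. by exists (rec_proj i). Qed.

Lemma rec_S f : cf f -> cf (fun a => (f a).+1).
Proof.
move=> fP; apply: (@rec_env 1 (fun a => [tuple f a])).
  by move=> i; rewrite (ord1 i).
by exists rec_succ.
Qed.

Lemma rec_const m : cf (fun=> m).
Proof. by elim: m => [|m IH]; [exists (rec_zero k)|exact: rec_S]. Qed.

Lemma rec_push0 : total_rec (push e) snd.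
Proof. by exists (rec_proj ord0). Qed.

End Closure.

Lemma rec_pushS A k (e : A -> k.-tuple nat) (f : A -> nat) :
  total_rec e f -> total_rec (push e) (fun z => f z.1).
Proof.
move=> [c cP]; apply: (@rec_env _ _ _ k (fun z => e z.1)) => [i|].
  exists (rec_proj (lift ord0 i)) => z y /=.
  by rewrite (tnth_nth 0) /= -tnth_nth.
by exists c => z y; exact: cP.
Qed.

(** Substitution under a binder: the bound variable becomes the computed value [v], and the
    remaining context becomes [u]. *)
Lemma rec_push_map A B k m (e : A -> k.-tuple nat) (e' : B -> m.-tuple nat)
    (u : B -> A) (v : B -> nat) (F : A * nat -> nat) :
  (forall i, total_rec e' (fun b => tnth (e (u b)) i)) -> total_rec e' v ->
  total_rec (push e) F -> total_rec e' (fun b => F (u b, v b)).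
Proof.
move=> eP vP FP; apply: (@rec_env _ _ _ _ (fun b => push e (u b, v b))).
  move=> i; case: (unliftP ord0 i) => [j|] ->; last exact: vP.
  have [c cP] := eP j; exists c => z y.
  by rewrite cP !(tnth_nth 0).
by have [c cP] := FP; exists c => z y; exact: cP.
Qed.

Lemma rec_iteri A k (e : A -> k.-tuple nat) (m f : A -> nat)
    (G : A -> nat -> nat -> nat) :
  total_rec e m -> total_rec e f ->
  total_rec (push (push e)) (fun z => G z.1.1 z.2 z.1.2) ->
  total_rec e (fun a => iteri (m a) (G a) (f a)).
Proof.
move=> mP [cf cfP] [cg cgP].
(* [rec_prim] reads the number of rounds from the head of its tuple, so [m a] is put in front of the
   environment. *)
apply: (@rec_env _ _ _ _ (fun a => [tuple of m a :: e a])).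
  move=> i; case: (unliftP ord0 i) => [j|] ->; last exact: mP.
  have [c cP] := @rec_tnth A k e j; exists c => a y.
  by rewrite cP !(tnth_nth 0) /= -tnth_nth.
exists (rec_prim cf cg) => a y /=.
rewrite theadE.
set x := behead_tuple _; have bE : x = e a by apply/val_inj.
have fP v : rec_eval cf x v <-> v = f a by rewrite bE.
have gP t s v : rec_eval cg [tuple of t :: s :: x] v <-> v = G a t s.
  rewrite -(cgP (a, s, t)).
  by rewrite (_ : [tuple of _] = push (push e) (a, s, t))//; exact/val_inj.
split=> [[s [/fP s0 sS ->]]|->].
  suff h t : t <= m a -> s t = iteri t (G a) (f a) by exact: h.
  elim: t => [//|t IH tm]; have /gP -> := sS t tm.
  by rewrite IH// ltnW.
exists (fun t => iteri t (G a) (f a)); split=> //; first exact/fP.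
by move=> t _; apply/gP.
Qed.

Lemma rec_ext A k (e : A -> k.-tuple nat) (f g : A -> nat) :
  f =1 g -> total_rec e f -> total_rec e g.
Proof. by move=> /funext ->. Qed.

Section Weakening.
Context {A : Type} {k : nat} {e : A -> k.-tuple nat}.
Variable f : A -> nat.
Hypothesis fP : total_rec e f.

Lemma rec_push2 : total_rec (push (push e)) (fun z => f z.1.1).
Proof. exact: rec_pushS (rec_pushS fP). Qed.

Lemma rec_push3 : total_rec (push (push (push e))) (fun z => f z.1.1.1).
Proof. exact: rec_pushS rec_push2. Qed.

Lemma rec_push4 : total_rec (push (push (push (push e)))) (fun z => f z.1.1.1.1).
Proof. exact: rec_pushS rec_push3. Qed.

End Weakening.

Ltac rec_var :=
  let base := first [eassumption | exact: rec_push0 | exact: rec_const] in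
  cbn beta; first [base | simple eapply rec_pushS; base
  | simple eapply rec_push2; base | simple eapply rec_push3; base
  | simple eapply rec_push4; base].

(** A Boolean serves as an iteration count, 0 or 1, choosing between the start value and the
    step. *)
Lemma rec_if A k (e : A -> k.-tuple nat) (b : A -> bool) (f g : A -> nat) :
  cb e b -> total_rec e f -> total_rec e g ->
  total_rec e (fun a => if b a then f a else g a).
Proof.
move=> bP fP gP.
apply: (@rec_ext _ _ _ (fun a => iteri (b a) (fun _ _ => f a) (g a))).
  by move=> a /=; case: (b a).
by apply: rec_iteri => //; rec_var.
Qed.

Lemma rec_pred A k (e : A -> k.-tuple nat) (f : A -> nat) :
  total_rec e f -> total_rec e (fun a => (f a).-1).
Proof.
move=> fP; apply: (@rec_ext _ _ _ (fun a => iteri (f a) (fun t _ => t) 0)).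
  by move=> a /=; case: (f a).
by apply: rec_iteri => //; [exact: rec_const|exact: rec_push0].
Qed.

Lemma rec_add A k (e : A -> k.-tuple nat) (f g : A -> nat) :
  total_rec e f -> total_rec e g -> total_rec e (fun a => f a + g a).
Proof.
move=> fP gP.
apply: (@rec_ext _ _ _ (fun a => iteri (f a) (fun _ s => s.+1) (g a))).
  by move=> a /=; elim: (f a) => //= t ->.
by apply: rec_iteri => //; apply: rec_S; apply: rec_pushS; exact: rec_push0.
Qed.

Lemma rec_sub A k (e : A -> k.-tuple nat) (f g : A -> nat) :
  total_rec e f -> total_rec e g -> total_rec e (fun a => f a - g a).
Proof.
move=> fP gP.
apply: (@rec_ext _ _ _ (fun a => iteri (g a) (fun _ s => s.-1) (f a))).
  by move=> a /=; elim: (g a) => [|t /= ->]; rewrite ?subn0// subnS.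
by apply: rec_iteri => //; apply: rec_pred; apply: rec_pushS; exact: rec_push0.
Qed.

Lemma rec_not A k (e : A -> k.-tuple nat) (b : A -> bool) :
  cb e b -> cb e (fun a => ~~ b a).
Proof.
move=> bP; apply: (@rec_ext _ _ _ (fun a => if b a then 0 else 1)).
  by move=> a; case: (b a).
by apply: rec_if => //; exact: rec_const.
Qed.

Lemma rec_eq0 A k (e : A -> k.-tuple nat) (f : A -> nat) :
  total_rec e f -> cb e (fun a => f a == 0).
Proof.
move=> fP; apply: (@rec_ext _ _ _ (fun a => 1 - f a)).
  by move=> a; case: (f a).
by apply: rec_sub => //; exact: rec_const.
Qed.

Lemma rec_leq A k (e : A -> k.-tuple nat) (f g : A -> nat) :
  total_rec e f -> total_rec e g -> cb e (fun a => f a <= g a).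
Proof. by move=> fP gP; apply/rec_eq0/rec_sub. Qed.

Lemma rec_and A k (e : A -> k.-tuple nat) (b1 b2 : A -> bool) :
  cb e b1 -> cb e b2 -> cb e (fun a => b1 a && b2 a).
Proof.
move=> h1 h2; apply: (@rec_ext _ _ _ (fun a => if b1 a then b2 a : nat else 0)).
  by move=> a; case: (b1 a).
by apply: rec_if => //; exact: rec_const.
Qed.

Lemma rec_or A k (e : A -> k.-tuple nat) (b1 b2 : A -> bool) :
  cb e b1 -> cb e b2 -> cb e (fun a => b1 a || b2 a).
Proof.
move=> h1 h2; apply: (@rec_ext _ _ _ (fun a => if b1 a then 1 else b2 a : nat)).
  by move=> a; case: (b1 a).
by apply: rec_if => //; exact: rec_const.
Qed.

Lemma rec_imp A k (e : A -> k.-tuple nat) (b1 b2 : A -> bool) :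
  cb e b1 -> cb e b2 -> cb e (fun a => b1 a ==> b2 a).
Proof.
move=> h1 h2; apply: (@rec_ext _ _ _ (fun a => ~~ b1 a || b2 a : nat)).
  by move=> a; case: (b1 a).
by apply: rec_or => //; exact: rec_not.
Qed.

Lemma rec_eqn A k (e : A -> k.-tuple nat) (f g : A -> nat) :
  total_rec e f -> total_rec e g -> cb e (fun a => f a == g a).
Proof.
move=> fP gP; apply: (@rec_ext _ _ _ (fun a => (f a <= g a) && (g a <= f a) : nat)).
  by move=> a; rewrite eqn_leq.
by apply: rec_and; exact: rec_leq.
Qed.

Lemma rec_mul A k (e : A -> k.-tuple nat) (f g : A -> nat) :
  total_rec e f -> total_rec e g -> total_rec e (fun a => f a * g a).
Proof.
move=> fP gP.
apply: (@rec_ext _ _ _ (fun a => iteri (f a) (fun _ s => g a + s) 0)).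
  by move=> a /=; elim: (f a) => //= t ->.
apply: rec_iteri => //; first exact: rec_const.
by apply: (@rec_ext _ _ _ (fun z => g z.1.1 + z.1.2))=> //; apply: rec_add; rec_var.
Qed.

(** Used for functions whose graph is easier to decide than the value is to compute, such as the
    head and the tail of a coded list. *)
Lemma rec_least A k (e : A -> k.-tuple nat) (P : A -> nat -> bool)
    (f : A -> nat) :
  total_rec (push e) (fun z => nat_of_bool (P z.1 z.2)) ->
  (forall a, P a (f a)) -> (forall a t, P a t -> f a <= t) -> total_rec e f.
Proof.
(* [rec_mu] searches for a zero, so the code tests the negation of [P]. *)
move=> /rec_not[c cP] Pf fmin; exists (rec_mu c) => a y /=.
have {}cP t v : rec_eval c [tuple of t :: e a] v <-> v = ~~ P a t.
  exact: (cP (a, t)).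
split=> [[/cP Py ylt]|->].
  apply/eqP; rewrite eqn_leq andbC fmin; last by move: Py; case: (P a y).
  rewrite leqNgt; apply/negP => /ylt[v /cP]; by rewrite Pf.
split=> [|t tf]; first by apply/cP; rewrite Pf.
exists 0; apply/cP; case E : (P a t) => //.
by move: tf; rewrite ltnNge fmin.
Qed.

(** The set is the domain of an unbounded search for [b]. Recursiveness is asked in every context so
    that it applies to the one extended by the search variable. *)
Lemma rec_exists_re (P : nat -> nat -> nat -> bool) :
  (forall A k (e : A -> k.-tuple nat) (f g h : A -> nat),
    total_rec e f -> total_rec e g -> total_rec e h ->
    total_rec e (fun a => nat_of_bool (P (f a) (g a) (h a)))) ->
  recursively_enumerable [set ij | exists b, P b ij.1 ij.2].
Proof.
move=> Pc; pose e (ij : nat * nat) := [tuple ij.1; ij.2].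
have fstP : total_rec e fst by exact: (@rec_tnth _ _ e ord0).
have sndP : total_rec e snd by exact: (@rec_tnth _ _ e (lift ord0 ord0)).
have [c cP] : cb (push e) (fun z => ~~ P z.2 z.1.1 z.1.2).
  by apply: rec_not; apply: Pc; [exact: rec_push0|exact: rec_pushS|exact: rec_pushS].
exists (rec_mu c) => i j /=.
have {}cP t v : rec_eval c [tuple of [:: t; i; j]] v <-> v = ~~ P t i j.
  rewrite -(cP (i, j, t)).
  by rewrite (_ : [tuple of _] = push e (i, j, t))//; exact/val_inj.
have tE t : [tuple of t :: [tuple i; j]] = [tuple of [:: t; i; j]].
  exact/val_inj.
split=> [exb|[y []]].
  have [b Pb bmin] := ex_minnP exb; exists b; split.
    by rewrite tE; apply/cP; rewrite Pb.
  move=> t tb; exists 0; rewrite tE; apply/cP; case E : (P t i j) => //.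
  by move: tb; rewrite ltnNge bmin.
by rewrite tE => /cP Py _; exists y; move: Py; case: (P y i j).
Qed.

(** * Bounded quantifiers and codes of finite sequences *)

Definition all_lt m (P : pred nat) := all P (iota 0 m).
Definition has_lt m (P : pred nat) := ~~ all_lt m (fun t => ~~ P t).

Lemma all_ltP m (P : pred nat) :
  reflect (forall t, t < m -> P t) (all_lt m P).
Proof.
apply: (iffP allP) => [h t tm|h t]; first by apply: h; rewrite mem_iota.
by rewrite mem_iota => /h.
Qed.

Lemma has_ltP m (P : pred nat) :
  reflect (exists2 t, t < m & P t) (has_lt m P).
Proof.
rewrite /has_lt /all_lt all_predC negbK; apply: (iffP hasP) => -[t].
  by rewrite mem_iota => tm Pt; exists t.
by exists t => //; rewrite mem_iota.
Qed.

Definition entry k s := nth 0 (CodeSeq.decode k) s.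
Definition shift k := CodeSeq.code (behead (CodeSeq.decode k)).

(** The head of a list is the 2-adic valuation of its code, and the odd part determines the tail;
    decoding thus reduces to powers of 2 and multiplication. *)
Lemma code_cons v m : CodeSeq.code (v :: CodeSeq.decode m) = 2 ^ v * m.*2.+1.
Proof. by rewrite /= CodeSeq.decodeK. Qed.

Lemma decode_pow v m : CodeSeq.decode (2 ^ v * m.*2.+1) = v :: CodeSeq.decode m.
Proof. by rewrite -code_cons CodeSeq.codeK. Qed.

Lemma shiftE k : 0 < k -> k = 2 ^ entry k 0 * (shift k).*2.+1.
Proof.
move=> k0; rewrite -code_cons /shift CodeSeq.codeK -[LHS]CodeSeq.decodeK.
rewrite /entry; case E : (CodeSeq.decode k) => [|v l]//.
by move: k0; rewrite -[k]CodeSeq.decodeK E.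
Qed.

Lemma entry_iter k s : entry k s = entry (iter s shift k) 0.
Proof.
elim: s k => [//|s IH] k; rewrite iterSr -IH /entry /shift CodeSeq.codeK.
by rewrite nth_behead.
Qed.

Lemma iter_shift k s :
  CodeSeq.decode (iter s shift k) = drop s (CodeSeq.decode k).
Proof.
elim: s => [|s IH]; first by rewrite drop0.
by rewrite iterS /shift CodeSeq.codeK IH -drop1 drop_drop.
Qed.

(** Since 0 codes only the empty list, iterating [shift] tests the length without a recursive size
    function. *)
Lemma entry_size k s : (iter s shift k == 0) = (size (CodeSeq.decode k) <= s).
Proof.
rewrite -subn_eq0 -size_drop size_eq0 -iter_shift.
by rewrite -(can_eq CodeSeq.decodeK).
Qed.

Lemma entry_le k s : entry k s <= k.
Proof.
rewrite /entry; have [sk|ks] := ltnP s (size (CodeSeq.decode k)).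
  by apply: ltnW; apply: (allP (CodeSeq.gtn_decode k)); exact: mem_nth.
by rewrite nth_default.
Qed.

Lemma size_decode k : size (CodeSeq.decode k) <= k.
Proof.
rewrite -{2}[k]CodeSeq.decodeK; elim: (CodeSeq.decode k) => //= v l IH.
apply: leq_ltn_trans IH _; apply: leq_trans (leq_pmull _ _).
  by rewrite ltnS -addnn leq_addr.
by rewrite expn_gt0.
Qed.

(** The bound [k] is at least the length of the list ([size_decode]); the guard skips positions past
    the end, where [entry] would return the default 0. *)
Definition all_in k (P : pred nat) :=
  all_lt k (fun s => (iter s shift k != 0) ==> P (entry k s)).
Definition has_in k (P : pred nat) := ~~ all_in k (fun p => ~~ P p).

Lemma all_inE k P : all_in k P = all P (CodeSeq.decode k).
Proof.
apply/all_ltP/(all_nthP 0) => [h s sk|h s _]; last first.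
  by apply/implyP; rewrite entry_size -ltnNge => /h.
have := h s; rewrite entry_size -ltnNge sk; apply.
exact: leq_trans sk (size_decode k).
Qed.

Lemma has_inE k P : has_in k P = has P (CodeSeq.decode k).
Proof. by rewrite /has_in all_inE all_predC negbK. Qed.

Lemma rec_all_lt A k (e : A -> k.-tuple nat) (f : A -> nat)
    (P : A -> nat -> bool) :
  total_rec e f ->
  total_rec (push e) (fun z => nat_of_bool (P z.1 z.2)) ->
  cb e (fun a => all_lt (f a) (P a)).
Proof.
(* The accumulator holds the conjunction so far, as 0 or 1. *)
move=> fP Pc; apply: (@rec_ext _ _ _ (fun a => iteri (f a) (fun t s =>
    if s == 0 then 0 else P a t : nat) 1)).
  move=> a; rewrite /all_lt; elim: (f a) => // t IH.
  rewrite -{2}(addn1 t) iotaD all_cat [LHS]/= {}IH /= andbT add0n.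
  by case: (all _ _).
apply: rec_iteri => //; first exact: rec_const.
apply: (@rec_ext _ _ _ (fun z => if z.1.2 == 0 then 0 else P z.1.1 z.2 : nat)) => //.
apply: rec_if; [|exact: rec_const|].
  by apply: rec_eq0; rec_var.
(* Drops the accumulator from the context, since [P] sees only [a] and the counter. *)
apply: (@rec_push_map _ _ _ _ e _ (fst \o fst) snd
  (fun z => nat_of_bool (P z.1 z.2))) => //.
  by move=> i; exact: (rec_push2 (rec_tnth i)).
exact: rec_push0.
Qed.

Lemma rec_has_lt A k (e : A -> k.-tuple nat) (f : A -> nat)
    (P : A -> nat -> bool) :
  total_rec e f ->
  total_rec (push e) (fun z => nat_of_bool (P z.1 z.2)) ->
  cb e (fun a => has_lt (f a) (P a)).
Proof.
move=> fP Pc; apply: rec_not.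
by apply: (@rec_all_lt _ _ _ _ (fun a t => ~~ P a t)) => //; exact: rec_not.
Qed.

Lemma rec_iter A k (e : A -> k.-tuple nat) (f g : A -> nat)
    (G : A -> nat -> nat) :
  total_rec e f -> total_rec e g ->
  total_rec (push (push e)) (fun z => G z.1.1 z.1.2) ->
  total_rec e (fun a => iter (f a) (G a) (g a)).
Proof. move=> fP gP GP.
apply: (@rec_ext _ _ _ (fun a => iteri (f a) (fun _ s => G a s) (g a))).
  by move=> a; elim: (f a) => //= t ->.
exact: (@rec_iteri _ _ _ _ _ (fun a _ s => G a s)). Qed.

Lemma rec_exp2 A k (e : A -> k.-tuple nat) (f : A -> nat) :
  total_rec e f -> total_rec e (fun a => 2 ^ f a).
Proof.
move=> fP; apply: (@rec_ext _ _ _ (fun a => iter (f a) (fun s => s + s) 1)).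
  by move=> a; elim: (f a) => //= t ->; rewrite expnS addnn mul2n.
apply: rec_iter => //; first exact: rec_const.
by apply: (@rec_ext _ _ _ (fun z => z.1.2 + z.1.2)) => //; apply: rec_add; rec_var.
Qed.

Lemma rec_double A k (e : A -> k.-tuple nat) (f : A -> nat) :
  total_rec e f -> total_rec e (fun a => (f a).*2).
Proof.
move=> fP; apply: (@rec_ext _ _ _ (fun a => f a + f a)); last exact: rec_add.
by move=> a; exact: addnn.
Qed.

(* Redefined below as more functions are shown to be recursive. *)
Ltac rec_hook := fail.
Ltac rec_auto := cbn beta; first [rec_var | first [rec_hook
  | simple eapply rec_and | simple eapply rec_or | simple eapply rec_imp
  | simple eapply rec_not | simple eapply rec_eqn | simple eapply rec_leq
  | simple eapply rec_mul | simple eapply rec_S | simple eapply rec_exp2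
  | simple eapply rec_double | simple eapply rec_add | simple eapply rec_pred
  | simple eapply rec_all_lt | simple eapply rec_has_lt]; rec_auto].

Lemma rec_shift A k (e : A -> k.-tuple nat) (f : A -> nat) :
  total_rec e f -> total_rec e (fun a => shift (f a)).
Proof.
(* The search runs over the tail [m]; the head is below the code and needs only a bounded
   quantifier. The first disjunct stops the search at 0 when the list is empty. *)
move=> fP; apply: (@rec_least _ _ _ (fun a m => (f a == 0) ||
    has_lt (f a) (fun v => f a == 2 ^ v * m.*2.+1))).
- by rec_auto.
- move=> a; have [//|fa0] := posnP (f a); apply/has_ltP.
  exists (entry (f a) 0); last by rewrite /= {1}(shiftE fa0).
  apply: (allP (CodeSeq.gtn_decode (f a))); apply: mem_nth.
  by rewrite ltnNge -entry_size /= -lt0n.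
- move=> a m /orP[/eqP ->//|/has_ltP[v _ /eqP ->]].
  by rewrite /shift decode_pow /= CodeSeq.decodeK.
Qed.

Ltac rec_hook ::= simple eapply rec_shift.

Lemma rec_entry0 A k (e : A -> k.-tuple nat) (f : A -> nat) :
  total_rec e f -> total_rec e (fun a => entry (f a) 0).
Proof.
move=> fP; apply: (@rec_least _ _ _ (fun a v => (f a == 0) ||
    (f a == 2 ^ v * (shift (f a)).*2.+1))).
- by rec_auto.
- move=> a; have [->//|fa0] := posnP (f a).
  by rewrite -shiftE// eqxx orbT.
- move=> a v /orP[/eqP ->//|/eqP ->].
  by rewrite /entry decode_pow.
Qed.

Lemma rec_iter_shift A k (e : A -> k.-tuple nat) (f g : A -> nat) :
  total_rec e f -> total_rec e g ->
  total_rec e (fun a => iter (g a) shift (f a)).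
Proof.
by move=> fP gP; apply: (@rec_iter _ _ _ _ _ (fun _ s => shift s)) => //; rec_auto.
Qed.

Lemma rec_entry A k (e : A -> k.-tuple nat) (f g : A -> nat) :
  total_rec e f -> total_rec e g -> total_rec e (fun a => entry (f a) (g a)).
Proof.
move=> fP gP; under [fun a => _]funext do rewrite entry_iter.
exact/rec_entry0/rec_iter_shift.
Qed.

Ltac rec_hook ::=
  first [simple eapply rec_entry | simple eapply rec_iter_shift].

Lemma rec_all_in A k (e : A -> k.-tuple nat) (f : A -> nat)
    (P : A -> nat -> bool) :
  total_rec e f -> total_rec (push e) (fun z => nat_of_bool (P z.1 z.2)) ->
  total_rec e (fun a => nat_of_bool (all_in (f a) (P a))).
Proof.
move=> fP Pc; apply: (@rec_all_lt _ _ _ f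
  (fun a s => (iter s shift (f a) != 0) ==> P a (entry (f a) s))) => //.
apply: rec_imp.
  by rec_auto.
apply: (@rec_push_map _ _ _ _ e _ fst (fun z => entry (f z.1) z.2)
  (fun z => nat_of_bool (P z.1 z.2))) => //.
  by move=> i; exact: (rec_pushS (rec_tnth i)).
by apply: rec_entry; rec_var.
Qed.

Lemma rec_has_in A k (e : A -> k.-tuple nat) (f : A -> nat)
    (P : A -> nat -> bool) :
  total_rec e f -> total_rec (push e) (fun z => nat_of_bool (P z.1 z.2)) ->
  total_rec e (fun a => nat_of_bool (has_in (f a) (P a))).
Proof.
move=> fP Pc; apply: rec_not.
by apply: (@rec_all_in _ _ _ _ (fun a t => ~~ P a t)) => //; exact: rec_not.
Qed.

(** * Decision procedures on codes *)

(** With rationals coded as (a - b) / (d + 1), this is the cross-multiplied inequality with the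
    negative terms moved across, so that only natural numbers occur. *)
Definition qle c c' :=
  entry c 0 * (entry c' 2).+1 + entry c' 1 * (entry c 2).+1 <=
  entry c' 0 * (entry c 2).+1 + entry c 1 * (entry c' 2).+1.

Lemma qleE c c' : qle c c' = (rat_enum c <= rat_enum c')%R.
Proof.
rewrite /rat_enum -!/(entry _ _) ler_pdivrMr ?ltr0n// mulrAC ler_pdivlMr ?ltr0n//.
by rewrite !mulrBl lerBlDr addrAC lerBrDr -!natrM -!natrD ler_nat.
Qed.

Definition qmin c c' := if qle c c' then c else c'.
Definition qmax c c' := if qle c c' then c' else c.

Lemma qminE c c' : rat_enum (qmin c c') = Num.min (rat_enum c) (rat_enum c').
Proof. by rewrite /qmin qleE minElt; case: ltgtP. Qed.

Lemma qmaxE c c' : rat_enum (qmax c c') = Num.max (rat_enum c) (rat_enum c').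
Proof. by rewrite /qmax qleE maxElt; case: ltgtP. Qed.

Definition lo k s := qmin (entry (entry k 0) s) (entry (entry k 1) s).
Definition hi k s := qmax (entry (entry k 0) s) (entry (entry k 1) s).

(** Endpoints are nested entries of the code and never new rationals, so those of a box with code at
    most [N] lie on the grid of codes up to [N]. *)
Lemma lo_le k s : lo k s <= k.
Proof.
by rewrite /lo /qmin; case: ifP => _; apply: leq_trans (entry_le _ _) (entry_le _ _).
Qed.

Lemma hi_le k s : hi k s <= k.
Proof.
by rewrite /hi /qmax; case: ifP => _; apply: leq_trans (entry_le _ _) (entry_le _ _).
Qed.

Lemma corner_minE n k (i : 'I_n) : corner_min n k ord0 i = rat_enum (lo k i).
Proof. by rewrite /corner_min !mxE qminE. Qed.

Lemma corner_maxE n k (i : 'I_n) : corner_max n k ord0 i = rat_enum (hi k i).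
Proof. by rewrite /corner_max !mxE qmaxE. Qed.

Definition in_box n k z := all_lt n (fun s =>
  qle (lo k s) (entry z s) && qle (entry z s) (hi k s)).
Definition in_boxes n i z := has_in i (fun k => in_box n k z).
Definition in_IR n u z := (u == 0) || in_box n u.-1 z.
Definition in_KR n i z := (i == 0) || in_boxes n i z.

(** [adj n N w z]: the point coded by [z] lies in the closure of the cell of the
    point coded by [w] in the grid of the coordinate values coded up to [N]. *)
Definition adj n N w z := all_lt n (fun s => all_lt N.+1 (fun c =>
  (qle (entry w s) c ==> qle (entry z s) c) &&
  (qle c (entry w s) ==> qle c (entry z s)))).

(** The criterion of [interior_grid_set], with [w] running over the test points, one or more per
    cell. *)
Definition int_IR n N B u z := all_lt B (fun w => adj n N w z ==> in_IR n u w).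
Definition int_KR n N B i z := all_lt B (fun w => adj n N w z ==> in_KR n i w).

(** The rationals coded below [b] meet every cell of the one-dimensional grid. *)
Definition adequate N b := (N < b) && all_lt N.+1 (fun c =>
  [&& has_lt b (fun t => ~~ qle c t), has_lt b (fun t => ~~ qle t c) &
  all_lt N.+1 (fun c' =>
    qle c' c || has_lt b (fun t => ~~ qle t c && ~~ qle c' t))]).

(** One more than the code of the list of [n] entries equal to [b], the largest code of a list of
    length [n] with entries at most [b]. *)
Definition bound n b := (iter n (fun m => 2 ^ b * m.*2.+1) 0).+1.

(** Decides [bounded_steps]: at each test point [x] the values of the active steps share a test
    point [y]. *)
Definition consistent n N b j := all_lt (bound n b) (fun x =>
  has_lt (bound 1 b) (fun y => all_in j (fun p =>
    int_IR n N (bound n b) (entry p 0) x ==> in_IR 1 (entry p 1) y))).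

(** Index 0 is the bottom element, with endpoints at infinity; a positive index [v] stands for the
    box with code [v.-1]. *)
Definition lower_lt v v' :=
  (v' != 0) && ((v == 0) || ~~ qle (lo v'.-1 0) (lo v.-1 0)).
Definition upper_lt v v' :=
  (v != 0) && ((v' == 0) || ~~ qle (hi v'.-1 0) (hi v.-1 0)).
Definition upper_lt_lower v v' :=
  [&& v != 0, v' != 0 & ~~ qle (lo v'.-1 0) (hi v.-1 0)].

Definition meets_dec n N b kX u := has_lt (bound n b) (fun x =>
  in_boxes n kX x && int_IR n N (bound n b) u x).

(** An inconsistent [j] enumerates the bottom function, whose maximal value is bottom and has only
    bottom way below it; hence consistency guards everything except [i == 0]. *)
Definition maxV_dec n N b kX i j := (i == 0) || [&& consistent n N b j,
  has_in j (fun q => lower_lt i (entry q 1) && meets_dec n N b kX (entry q 0)) &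
  all_lt (bound n b) (fun x => in_boxes n kX x ==> has_in j (fun p =>
    upper_lt (entry p 1) i && int_IR n N (bound n b) (entry p 0) x))].

(** For an inconsistent [j] the maximum set is all of [X], so consistency guards only the
    alternative in which [x] is excluded from that set. *)
Definition maxS_dec n N b kX i j := (i == 0) ||
  all_lt (bound n b) (fun x => in_boxes n kX x ==>
    int_KR n N (bound n b) i x || consistent n N b j && has_in j (fun p =>
      int_IR n N (bound n b) (entry p 0) x && has_in j (fun q =>
        upper_lt_lower (entry p 1) (entry q 1) &&
        meets_dec n N b kX (entry q 0)))).

(** * Recursiveness of the decision procedures *)

Ltac rec_hook ::= first [simple eapply rec_entry
  | simple eapply rec_all_in | simple eapply rec_has_in].

Lemma rec_qle A k (e : A -> k.-tuple nat) (f g : A -> nat) :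
  total_rec e f -> total_rec e g -> cb e (fun a => qle (f a) (g a)).
Proof. by rewrite /qle => fP gP; rec_auto. Qed.

Lemma rec_qmin A k (e : A -> k.-tuple nat) (f g : A -> nat) :
  total_rec e f -> total_rec e g -> total_rec e (fun a => qmin (f a) (g a)).
Proof. by move=> fP gP; apply: rec_if => //; exact: rec_qle. Qed.

Lemma rec_qmax A k (e : A -> k.-tuple nat) (f g : A -> nat) :
  total_rec e f -> total_rec e g -> total_rec e (fun a => qmax (f a) (g a)).
Proof. by move=> fP gP; apply: rec_if => //; exact: rec_qle. Qed.

Ltac rec_hook ::= first [simple eapply rec_entry | simple eapply rec_qle
  | simple eapply rec_qmin | simple eapply rec_qmax
  | simple eapply rec_all_in | simple eapply rec_has_in].

Lemma rec_lo A k (e : A -> k.-tuple nat) (f g : A -> nat) :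
  total_rec e f -> total_rec e g -> total_rec e (fun a => lo (f a) (g a)).
Proof. by rewrite /lo => fP gP; rec_auto. Qed.

Lemma rec_hi A k (e : A -> k.-tuple nat) (f g : A -> nat) :
  total_rec e f -> total_rec e g -> total_rec e (fun a => hi (f a) (g a)).
Proof. by rewrite /hi => fP gP; rec_auto. Qed.

Ltac rec_hook ::= first [simple eapply rec_entry | simple eapply rec_qle
  | simple eapply rec_lo | simple eapply rec_hi
  | simple eapply rec_all_in | simple eapply rec_has_in].

Lemma rec_in_box n A k (e : A -> k.-tuple nat) (f g : A -> nat) :
  total_rec e f -> total_rec e g -> cb e (fun a => in_box n (f a) (g a)).
Proof. by rewrite /in_box => fP gP; rec_auto. Qed.

Ltac rec_hook ::= first [simple eapply rec_entry | simple eapply rec_qle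
  | simple eapply rec_lo | simple eapply rec_hi | simple eapply rec_in_box
  | simple eapply rec_all_in | simple eapply rec_has_in].

Lemma rec_in_boxes n A k (e : A -> k.-tuple nat) (f g : A -> nat) :
  total_rec e f -> total_rec e g -> cb e (fun a => in_boxes n (f a) (g a)).
Proof. by rewrite /in_boxes => fP gP; rec_auto. Qed.

Lemma rec_in_IR n A k (e : A -> k.-tuple nat) (f g : A -> nat) :
  total_rec e f -> total_rec e g -> cb e (fun a => in_IR n (f a) (g a)).
Proof. by rewrite /in_IR => fP gP; rec_auto. Qed.

Lemma rec_adj n A k (e : A -> k.-tuple nat) (f g h : A -> nat) :
  total_rec e f -> total_rec e g -> total_rec e h ->
  cb e (fun a => adj n (f a) (g a) (h a)).
Proof. by rewrite /adj => fP gP hP; rec_auto. Qed.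

Lemma rec_adequate A k (e : A -> k.-tuple nat) (f g : A -> nat) :
  total_rec e f -> total_rec e g -> cb e (fun a => adequate (f a) (g a)).
Proof. by rewrite /adequate => fP gP; rec_auto. Qed.

Lemma rec_bound n A k (e : A -> k.-tuple nat) (f : A -> nat) :
  total_rec e f -> total_rec e (fun a => bound n (f a)).
Proof.
move=> fP; apply: rec_S; apply: (@rec_iter _ _ _ (fun=> n) (fun=> 0)
  (fun a m => 2 ^ f a * m.*2.+1)); rec_auto.
Qed.

Ltac rec_hook ::= first [simple eapply rec_entry | simple eapply rec_qle
  | simple eapply rec_lo | simple eapply rec_hi | simple eapply rec_in_box
  | simple eapply rec_in_boxes | simple eapply rec_in_IR | simple eapply rec_adj
  | simple eapply rec_bound
  | simple eapply rec_all_in | simple eapply rec_has_in].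

Lemma rec_in_KR n A k (e : A -> k.-tuple nat) (f g : A -> nat) :
  total_rec e f -> total_rec e g -> cb e (fun a => in_KR n (f a) (g a)).
Proof. by rewrite /in_KR => fP gP; rec_auto. Qed.

Lemma rec_int_IR n A k (e : A -> k.-tuple nat) (N B u z : A -> nat) :
  total_rec e N -> total_rec e B -> total_rec e u -> total_rec e z ->
  cb e (fun a => int_IR n (N a) (B a) (u a) (z a)).
Proof. by rewrite /int_IR => NP BP uP zP; rec_auto. Qed.

Lemma rec_lower_lt A k (e : A -> k.-tuple nat) (f g : A -> nat) :
  total_rec e f -> total_rec e g -> cb e (fun a => lower_lt (f a) (g a)).
Proof. by rewrite /lower_lt => fP gP; rec_auto. Qed.

Lemma rec_upper_lt A k (e : A -> k.-tuple nat) (f g : A -> nat) :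
  total_rec e f -> total_rec e g -> cb e (fun a => upper_lt (f a) (g a)).
Proof. by rewrite /upper_lt => fP gP; rec_auto. Qed.

Lemma rec_upper_lt_lower A k (e : A -> k.-tuple nat) (f g : A -> nat) :
  total_rec e f -> total_rec e g -> cb e (fun a => upper_lt_lower (f a) (g a)).
Proof. by rewrite /upper_lt_lower => fP gP; rec_auto. Qed.

Ltac rec_hook ::= first [simple eapply rec_entry
  | simple eapply rec_in_boxes | simple eapply rec_in_IR | simple eapply rec_in_KR
  | simple eapply rec_adj | simple eapply rec_bound | simple eapply rec_int_IR
  | simple eapply rec_lower_lt | simple eapply rec_upper_lt
  | simple eapply rec_upper_lt_lower
  | simple eapply rec_all_in | simple eapply rec_has_in].

Lemma rec_int_KR n A k (e : A -> k.-tuple nat) (N B u z : A -> nat) :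
  total_rec e N -> total_rec e B -> total_rec e u -> total_rec e z ->
  cb e (fun a => int_KR n (N a) (B a) (u a) (z a)).
Proof. by rewrite /int_KR => NP BP uP zP; rec_auto. Qed.

Lemma rec_consistent n A k (e : A -> k.-tuple nat) (N b j : A -> nat) :
  total_rec e N -> total_rec e b -> total_rec e j ->
  cb e (fun a => consistent n (N a) (b a) (j a)).
Proof. by rewrite /consistent => NP bP jP; rec_auto. Qed.

Lemma rec_meets_dec n A k (e : A -> k.-tuple nat) (N b kX u : A -> nat) :
  total_rec e N -> total_rec e b -> total_rec e kX -> total_rec e u ->
  cb e (fun a => meets_dec n (N a) (b a) (kX a) (u a)).
Proof. by rewrite /meets_dec => NP bP XP uP; rec_auto. Qed.

Ltac rec_hook ::= first [simple eapply rec_entry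
  | simple eapply rec_in_boxes
  | simple eapply rec_bound | simple eapply rec_int_IR | simple eapply rec_int_KR
  | simple eapply rec_lower_lt | simple eapply rec_upper_lt
  | simple eapply rec_upper_lt_lower | simple eapply rec_consistent
  | simple eapply rec_meets_dec
  | simple eapply rec_all_in | simple eapply rec_has_in].

Lemma rec_maxV_dec n A k (e : A -> k.-tuple nat) (N b kX i j : A -> nat) :
  total_rec e N -> total_rec e b -> total_rec e kX ->
  total_rec e i -> total_rec e j ->
  cb e (fun a => maxV_dec n (N a) (b a) (kX a) (i a) (j a)).
Proof. by rewrite /maxV_dec => NP bP XP iP jP; rec_auto. Qed.

Lemma rec_maxS_dec n A k (e : A -> k.-tuple nat) (N b kX i j : A -> nat) :
  total_rec e N -> total_rec e b -> total_rec e kX ->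
  total_rec e i -> total_rec e j ->
  cb e (fun a => maxS_dec n (N a) (b a) (kX a) (i a) (j a)).
Proof. by rewrite /maxS_dec => NP bP XP iP jP; rec_auto. Qed.

(** The witness is a bound for the codes of the rational test points. *)
Lemma enumerable_of_adequate (kX : nat) (S : set (nat * nat))
    (dec : nat -> nat -> nat -> nat -> nat -> bool) :
  (forall A k (e : A -> k.-tuple nat) (N b kX i j : A -> nat),
    total_rec e N -> total_rec e b -> total_rec e kX ->
    total_rec e i -> total_rec e j ->
    cb e (fun a => dec (N a) (b a) (kX a) (i a) (j a))) ->
  (forall N, exists b, adequate N b) ->
  (forall i j b, adequate (i + j + kX) b ->
    S (i, j) <-> dec (i + j + kX) b kX i j) ->
  recursively_enumerable S.
Proof.
move=> decP ex_b SP.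
have -> : S = [set ij | exists b,
    adequate (ij.1 + ij.2 + kX) b && dec (ij.1 + ij.2 + kX) b kX ij.1 ij.2].
  apply/seteqP; split=> [[i j] Sij|[i j] /= [b /andP[bP]]]; last by move/(SP _ _ _ bP).
  by have [b bP] := ex_b (i + j + kX); exists b; rewrite /= bP; apply/(SP _ _ _ bP).
apply: (@rec_exists_re (fun b i j =>
  adequate (i + j + kX) b && dec (i + j + kX) b kX i j)).
move=> A k e f g h fP gP hP.
have NP : total_rec e (fun a => g a + h a + kX).
  by rec_auto.
apply: rec_and; first exact: rec_adequate.
by apply: decP => //; exact: rec_const.
Qed.

(** * Cells of a rational grid *)

Section Grid.
Context {R : realType}.
Local Open Scope ring_scope.

Definition grid (c : nat) : R := ratr (rat_enum c).

Lemma grid_le c c' : (grid c <= grid c') = qle c c'.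
Proof. by rewrite /grid ler_rat qleE. Qed.

Lemma grid_lt c c' : (grid c < grid c') = ~~ qle c' c.
Proof. by rewrite ltNge grid_le. Qed.

Lemma adequate_exists N : exists b, adequate N b.
Proof.
(* Finitely many pairs of grid codes need finitely many witnesses, so one bound on the codes of the
   witnesses serves all pairs. *)
have bnd (P : nat -> nat -> rat -> Prop) : (forall c c', exists r, P c c' r) ->
    exists b, forall c c', (c <= N)%N -> (c' <= N)%N ->
      exists2 t, (t < b)%N & P c c' (rat_enum t).
  move=> ex_r; have /choice[t tP] cc : exists t, P cc.1 cc.2 (rat_enum t).
    by have [r Pr] := ex_r cc.1 cc.2; have [t tr] := rat_enum_surj r;
      exists t; rewrite tr.
  pose m := (\max_(c < N.+1) \max_(c' < N.+1) t (c : nat, c' : nat))%N.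
  exists m.+1 => c c' cN c'N; exists (t (c, c')); last exact: tP (c, c').
  rewrite ltnS /m (bigD1 (Ordinal (cN : c < N.+1)%N))//= leq_max.
  by rewrite (bigD1 (Ordinal (c'N : c' < N.+1)%N))//= leq_max leqnn.
have lt1 (r : rat) : r - 1 < r by rewrite gtrBl.
have lt2 (r : rat) : r < r + 1 by rewrite ltrDl.
have [b1 b1P] := bnd (fun c _ r => r < rat_enum c)
  (fun c _ => ex_intro _ (rat_enum c - 1) (lt1 _)).
have [b2 b2P] := bnd (fun c _ r => rat_enum c < r)
  (fun c _ => ex_intro _ (rat_enum c + 1) (lt2 _)).
have [b3 b3P] : exists b, forall c c', (c <= N)%N -> (c' <= N)%N ->
    exists2 t, (t < b)%N & rat_enum c < rat_enum c' ->
      rat_enum c < rat_enum t < rat_enum c'.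
  (* The implication makes the condition satisfiable for every pair, as [bnd] demands; the midpoint
     serves when the order is right. *)
  apply: (bnd (fun c c' r => rat_enum c < rat_enum c' ->
    rat_enum c < r < rat_enum c')) => c c'.
  exists ((rat_enum c + rat_enum c') / 2) => cc'.
  by rewrite !(midf_lt cc').
exists (maxn N.+1 (maxn b1 (maxn b2 b3))); apply/andP; split.
  by rewrite leq_max leqnn.
have ltE c c' : ~~ qle c c' = (rat_enum c' < rat_enum c) by rewrite qleE ltNge.
apply/all_ltP => c; rewrite ltnS => cN; apply/and3P; split.
- have [t tb tc] := b1P c c cN cN; apply/has_ltP; exists t; rewrite ?ltE//.
  by rewrite !leq_max tb !orbT.
- have [t tb tc] := b2P c c cN cN; apply/has_ltP; exists t; rewrite ?ltE//.
  by rewrite !leq_max tb !orbT.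
- apply/all_ltP => c' c'N; case E : (qle c' c) => //=; apply/has_ltP.
  have [t tb tc] := b3P c c' cN c'N; exists t; first by rewrite !leq_max tb !orbT.
  by rewrite !ltE; apply: tc; rewrite -ltE E.
Qed.

Lemma scalar_test N b (x : R) : adequate N b -> exists2 t, (t < b)%N &
  forall c, (c <= N)%N ->
    (x <= grid c) = (grid t <= grid c) /\ (grid c <= x) = (grid c <= grid t).
Proof.
move=> /andP[Nb /all_ltP adq].
(* A grid value is its own test point, which is why [adequate] includes [N < b]. *)
have [[c cN xc]|nx] := pselect (exists2 c, (c <= N)%N & x = grid c).
  by exists c => [|c' _]; [exact: leq_ltn_trans Nb|rewrite xc].
suff [t tb tP] : exists2 t, (t < b)%N & forall c, (c <= N)%N ->
    (x < grid c -> grid t < grid c) /\ (grid c < x -> grid c < grid t).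
  exists t => // c cN; have [tl tg] := tP c cN.
  have [xc|cx|xc] := ltgtP x (grid c).
  - by have /ltW -> := tl xc; rewrite leNgt tl.
  - by have /ltW -> := tg cx; rewrite [grid t <= _]leNgt tg.
  - by case: nx; exists c.
have ltE c c' : ~~ qle c c' = (grid c' < grid c) by rewrite grid_lt.
pose below := [pred c : 'I_N.+1 | grid c < x].
pose above := [pred c : 'I_N.+1 | x < grid c].
(* The nearest grid values on the two sides of [x] determine its cell; the test point is taken
   between them, or beyond the only one that exists. *)
have lo_max : (exists2 c1, below c1 & forall c, below c -> grid c <= grid c1)
    \/ (forall c, ~~ below c).
  case: (pickP below) => [c0 c0P|nb]; last by right=> c; rewrite nb.
  by left; case: (arg_maxP (fun c : 'I_N.+1 => grid c) c0P) => c1; exists c1.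
have hi_min : (exists2 c2, above c2 & forall c, above c -> grid c2 <= grid c)
    \/ (forall c, ~~ above c).
  case: (pickP above) => [c0 c0P|na]; last by right=> c; rewrite na.
  by left; case: (arg_minP (fun c : 'I_N.+1 => grid c) c0P) => c1; exists c1.
have belowP c (cN : (c <= N)%N) : grid c < x -> below (Ordinal (cN : c < N.+1)%N).
  by [].
have aboveP c (cN : (c <= N)%N) : x < grid c -> above (Ordinal (cN : c < N.+1)%N).
  by [].
case: lo_max => [[c1 c1x c1max]|nb]; case: hi_min => [[c2 c2x c2min]|na].
- have /and3P[_ _ /all_ltP/(_ c2 (ltn_ord c2))] := adq _ (ltn_ord c1).
  rewrite -grid_le leNgt (lt_trans c1x c2x)/= => /has_ltP[t tb].
  rewrite !ltE => /andP[t1 t2]; exists t => // c cN; split.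
    by move=> /(aboveP _ cN)/c2min/(lt_le_trans t2).
  by move=> /(belowP _ cN)/c1max/le_lt_trans; apply.
- have /and3P[_ /has_ltP[t tb] + _] := adq _ (ltn_ord c1).
  rewrite ltE => t1; exists t => // c cN; split.
    by move=> /(aboveP _ cN); rewrite (negbTE (na _)).
  by move=> /(belowP _ cN)/c1max/le_lt_trans; apply.
- have /and3P[/has_ltP[t tb] + _ _] := adq _ (ltn_ord c2).
  rewrite ltE => t1; exists t => // c cN; split.
    by move=> /(aboveP _ cN)/c2min/(lt_le_trans t1).
  by move=> /(belowP _ cN); rewrite (negbTE (nb _)).
(* Some side is occupied, because code 0 always belongs to the grid. *)
- have [|xc|cx] := ltgtP x (grid 0).
  + by move=> /(aboveP _ (leq0n N)); rewrite (negbTE (na _)).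
  + by move: xc => /(belowP _ (leq0n N)); rewrite (negbTE (nb _)).
  + by case: nx; exists 0%N.
Qed.

Lemma code_bound n b (l : seq nat) :
  size l = n -> all (fun c => (c <= b)%N) l ->
  (CodeSeq.code l < bound n b)%N.
Proof.
move=> <-; rewrite /bound ltnS; elim: l => //= c l IH /andP[cb /IH {}IH].
by rewrite leq_mul ?leq_pexp2l// ltnS leq_double.
Qed.

Section Cells.
Context {n : nat}.
Implicit Types (x y w : 'rV[R]_n) (K : set 'rV[R]_n) (N b : nat).

Definition same_cell N x y := forall (i : 'I_n) c, (c <= N)%N ->
  (x ord0 i <= grid c) = (y ord0 i <= grid c) /\
  (grid c <= x ord0 i) = (grid c <= y ord0 i).

(** The closure of the cell of [w] keeps exactly the weak inequalities that hold at [w]. *)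
Definition cell_closure N w x := forall (i : 'I_n) c, (c <= N)%N ->
  (w ord0 i <= grid c -> x ord0 i <= grid c) /\
  (grid c <= w ord0 i -> grid c <= x ord0 i).

Definition grid_set N K := forall x y, same_cell N x y -> K x -> K y.

Lemma same_cellC N x y : same_cell N x y -> same_cell N y x.
Proof. by move=> xy i c cN; have [-> ->] := xy i c cN. Qed.

Lemma cell_closure_same N w w' x x' : same_cell N w w' -> same_cell N x x' ->
  cell_closure N w x -> cell_closure N w' x'.
Proof.
move=> ww xx wx i c cN; have [<- <-] := ww i c cN; have [<- <-] := xx i c cN.
exact: wx.
Qed.

(** The strict inequalities between [x] and the finitely many grid values persist nearby; their
    contrapositives are the implications of [cell_closure]. *)
Lemma near_cell_closure N x : \forall w \near x, cell_closure N w x.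
Proof.
have h (i : 'I_n) (c : 'I_N.+1) : \forall w \near x,
    ((w : 'rV[R]_n) ord0 i <= grid c -> x ord0 i <= grid c) /\
    (grid c <= w ord0 i -> grid c <= x ord0 i).
  have coord (P : set R) : open P -> P (x ord0 i) -> \forall w \near x,
      P ((w : 'rV[R]_n) ord0 i).
    move=> oP Px; apply: (@coord_continuous R _ _ ord0 i x P).
    exact: open_nbhs_nbhs.
  have [xc|cx|xc] := ltgtP (x ord0 i) (grid c).
  - apply: filterS (coord [set t | t < grid c] (@open_lt _ _) xc) => w /= wc.
    by split=> //; rewrite leNgt wc.
  - apply: filterS (coord [set t | grid c < t] (@open_gt _ _) cx) => w /= wc.
    by split=> //; rewrite leNgt wc.
  - by near=> w.
have FF := nbhs_filter x.
have near_h := @filter_forall _ _ _ (nbhs x) FF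
  (fun i => @filter_forall _ _ _ (nbhs x) FF (h i)).
apply: filterS near_h => w hw i c cN.
exact: (hw i (Ordinal (cN : c < N.+1)%N)).
Unshelve. all: by end_near. Qed.

(** An inequality strict at [w] and weak at [x] is strict on the segment away from [x]; where [w]
    lies on a grid hyperplane, so does [x]. *)
Lemma segment_cell N w x (s : R) : 0 < s -> s <= 1 -> cell_closure N w x ->
  same_cell N w (x + s *: (w - x)).
Proof.
move=> s0 s1 wx i c cN; have [le ge] := wx i c cN; rewrite !mxE.
set wi := w ord0 i in le ge *; set xi := x ord0 i in le ge *.
have [wc|cw|wc] := ltgtP wi (grid c).
- have xc := le (ltW wc).
  have : xi + s * (wi - xi) < grid c by nra.
  by move=> /[dup] /ltW ->; rewrite ltNge => /negbTE ->.
- have cx := ge (ltW cw).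
  have : grid c < xi + s * (wi - xi) by nra.
  by move=> /[dup] /ltW ->; rewrite ltNge => /negbTE ->.
- have -> : xi = wi.
    by apply/le_anti; rewrite wc le ?wc ?lexx//= ge ?wc.
  by rewrite subrr mulr0 addr0 wc !lexx.
Qed.

(** A neighbourhood of [x] meets every cell with [x] in its closure, along the segment from [x] into
    the cell, and [K] contains each cell that it meets. Conversely, points near [x] lie only in such
    cells. *)
Lemma interior_grid_set N K x : grid_set N K ->
  K° x <-> forall w, cell_closure N w x -> K w.
Proof.
move=> gK; split=> [Kx w wx|h]; last first.
  by apply: filterS (near_cell_closure N x) => w; exact: h.
have cvgx : x + s *: (w - x) @[s --> 0^'+] --> x.
  apply: cvg_at_right_filter; rewrite -[X in _ --> X]addr0 -(scale0r (w - x)).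
  by apply: cvgD; [exact: cvg_cst|apply: cvgZl].
have [s [[s0 s1] Ks]] : exists s : R, (0 < s /\ s <= 1) /\ K (x + s *: (w - x)).
  apply: (@filter_ex _ (0^'+)%R); apply: filterI; last exact: cvgx.
  by apply: filterI; [exact: nbhs_right_gt|exact: nbhs_right_le].
apply: gK Ks; apply: same_cellC; exact: segment_cell.
Qed.

Lemma grid_set_interior N K : grid_set N K -> grid_set N K°.
Proof.
move=> gK x y xy; rewrite !(interior_grid_set _ gK) => Kx w wy; apply: Kx.
by apply: cell_closure_same wy => //; exact: same_cellC.
Qed.

Definition pt z : 'rV[R]_n := map_mx ratr (rat_point n z).

Lemma ptE z (i : 'I_n) : pt z ord0 i = grid (entry z i).
Proof. by rewrite !mxE. Qed.

Lemma test_point N b x : adequate N b ->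
  exists2 z, (z < bound n b)%N & same_cell N x (pt z).
Proof.
move=> adq; have /choice[t tP] (i : 'I_n) : exists t, (t < b)%N /\
    forall c, (c <= N)%N -> (x ord0 i <= grid c) = (grid t <= grid c) /\
      (grid c <= x ord0 i) = (grid c <= grid t).
  by have [t tb tP] := scalar_test (x ord0 i) adq; exists t.
exists (CodeSeq.code [seq t i | i <- enum 'I_n]).
  apply: code_bound; first by rewrite size_map size_enum_ord.
  by apply/allP => _ /mapP[i _ ->]; apply: ltnW; have [] := tP i.
move=> i c cN; have [_ /(_ c cN)] := tP i.
rewrite ptE /entry CodeSeq.codeK (nth_map i) ?size_enum_ord// nth_ord_enum.
exact.
Qed.

Lemma all_test N b K : adequate N b -> grid_set N K ->
  (forall x, K x) <-> forall z, (z < bound n b)%N -> K (pt z).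
Proof.
move=> adq gK; split=> [//|h x]; have [z zb xz] := test_point x adq.
by apply: gK (h z zb); exact: same_cellC.
Qed.

Lemma ex_test N b K : adequate N b -> grid_set N K ->
  (exists x, K x) <-> exists2 z, (z < bound n b)%N & K (pt z).
Proof.
move=> adq gK; split=> [[x Kx]|[z _ Kz]]; last by exists (pt z).
by have [z zb xz] := test_point x adq; exists z => //; exact: gK Kx.
Qed.

Lemma rat_boxP k x : IR_set (rat_box n k) x <->
  forall i : 'I_n, grid (lo k i) <= x ord0 i <= grid (hi k i).
Proof.
have E (i : 'I_n) : (map_mx ratr (corner_min n k) ord0 i = grid (lo k i)) *
    (map_mx ratr (corner_max n k) ord0 i = grid (hi k i)).
  by rewrite /grid -corner_minE -corner_maxE !mxE.
by split=> h i; have := h i; rewrite !E.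
Qed.

Lemma grid_set_box N k : (k <= N)%N -> grid_set N (IR_set (rat_box n k)).
Proof.
move=> kN x y xy /rat_boxP kx; apply/rat_boxP => i.
have [_ <-] := xy i _ (leq_trans (lo_le k i) kN).
by have [<- _] := xy i _ (leq_trans (hi_le k i) kN).
Qed.

Lemma grid_set_IR N u : (u <= N)%N -> grid_set N (IR_set (IR_enum n u)).
Proof. by case: u => [//|u] /ltnW uN; exact: grid_set_box. Qed.

Definition boxes kX : set 'rV[R]_n :=
  \bigcup_(k in [set` CodeSeq.decode kX]) IR_set (rat_box n k).

Lemma decode_le k m : m \in CodeSeq.decode k -> (m <= k)%N.
Proof. by move=> mk; apply/ltnW/(allP (CodeSeq.gtn_decode k)). Qed.

Lemma grid_set_boxes N kX : (kX <= N)%N -> grid_set N (boxes kX).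
Proof.
move=> kN x y xy [k kX_ kx]; exists k => //; apply: grid_set_box xy kx.
exact: leq_trans (decode_le kX_) kN.
Qed.

Lemma KR_enum_setE i :
  @KR_enum_set R n i = if i is 0 then setT else boxes i.
Proof.
rewrite /KR_enum_set /boxes; case: i => // i.
case E : (CodeSeq.decode i.+1) => //.
by have := CodeSeq.decodeK i.+1; rewrite E.
Qed.

Lemma grid_set_KR N i : (i <= N)%N -> grid_set N (KR_set (KR_enum n i)).
Proof.
by rewrite /= KR_enum_setE; case: i => [//|i iN]; exact: grid_set_boxes.
Qed.

Lemma in_boxP k z : IR_set (rat_box n k) (pt z) <-> in_box n k z.
Proof.
split=> [/rat_boxP h|/all_ltP h].
  by apply/all_ltP => s sn; have := h (Ordinal sn); rewrite ptE !grid_le.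
by apply/rat_boxP => i; rewrite ptE !grid_le; exact: h.
Qed.

Lemma in_IRP u z : IR_set (IR_enum n u) (pt z) <-> in_IR n u z.
Proof. by case: u => [//|u]; exact: in_boxP. Qed.

Lemma in_boxesP kX z : boxes kX (pt z) <-> in_boxes n kX z.
Proof.
rewrite /in_boxes has_inE; split=> [[k kX_ /in_boxP kz]|/hasP[k kX_ /in_boxP kz]].
  by apply/hasP; exists k.
by exists k.
Qed.

Lemma in_KRP i z : KR_set (KR_enum n i) (pt z) <-> in_KR n i z.
Proof.
by rewrite /= KR_enum_setE; case: i => [//|i]; exact: in_boxesP.
Qed.

Lemma adjP N (w z : nat) : cell_closure N (pt w) (pt z) <-> adj n N w z.
Proof.
split=> [h|/all_ltP h i c cN].
  apply/all_ltP => s sn; apply/all_ltP => c cN.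
  have := h (Ordinal sn) c cN; rewrite !ptE !grid_le => -[h1 h2].
  by apply/andP; split; apply/implyP.
have /all_ltP/(_ c cN)/andP[/implyP h1 /implyP h2] := h i (ltn_ord i).
by rewrite !ptE !grid_le.
Qed.

Lemma interior_testP N b K z : adequate N b -> grid_set N K ->
  K° (pt z) <-> forall w : nat, (w < bound n b)%N -> adj n N w z -> K (pt w).
Proof.
move=> adq gK; rewrite (interior_grid_set _ gK).
(* The condition on [w] depends only on its cell, so test points suffice. *)
rewrite (@all_test N b [set w | cell_closure N w (pt z) -> K w] adq); last first.
  move=> x y xy /= xz yz; apply: (gK _ _ xy); apply: xz.
  by apply: cell_closure_same yz => //; exact: same_cellC.
by split=> h w wb; move: (h w wb) => /= + /adjP; exact.
Qed.

Lemma int_IRP N b u z : adequate N b -> (u <= N)%N ->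
  (IR_set (IR_enum n u))° (pt z) <-> int_IR n N (bound n b) u z.
Proof.
move=> adq uN; rewrite (interior_testP _ adq (grid_set_IR uN)).
split=> [h|/all_ltP h w wb /(implyP (h w wb))/in_IRP//].
by apply/all_ltP => w wb; apply/implyP => /(h w wb)/in_IRP.
Qed.

Lemma int_KRP N b i z : adequate N b -> (i <= N)%N ->
  (KR_set (KR_enum n i))° (pt z) <-> int_KR n N (bound n b) i z.
Proof.
move=> adq iN; rewrite (interior_testP _ adq (grid_set_KR iN)).
split=> [h|/all_ltP h w wb /(implyP (h w wb))/in_KRP//].
by apply/all_ltP => w wb; apply/implyP => /(h w wb)/in_KRP.
Qed.

End Cells.

End Grid.

(** * Intervals *)

Section Intervals.
Context {R : realType}.
Local Open Scope ring_scope.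
Implicit Types (B C : IR R 1) (V : set (IR R 1)).

Lemma IR1E B y : IR_set B y <-> (lower B <= (y ord0 ord0)%:E <= upper B)%E.
Proof.
have [[-> -> ->]|[l [u [_ -> -> ->]]]] := IR1_cases B; first by rewrite leNye leey.
by rewrite /= !lee_fin.
Qed.

Lemma lower_upper_itv B (l u : \bar R) : (l <= u)%E -> l \is a fin_num ->
  u \is a fin_num ->
  IR_set B = [set y | (l <= (y ord0 ord0)%:E <= u)%E] ->
  lower B = l /\ upper B = u.
Proof.
move=> lu lfin ufin BE.
have mem r : (l <= r%:E <= u)%E -> (lower B <= r%:E <= upper B)%E.
  move=> h; suff /IR1E : IR_set B (const_mx r) by rewrite mxE.
  by rewrite BE /= mxE.
have /andP[Bl _] : (lower B <= l <= upper B)%E.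
  by rewrite -(fineK lfin); apply: mem; rewrite fineK// lexx.
have /andP[_ Bu] : (lower B <= u <= upper B)%E.
  by rewrite -(fineK ufin); apply: mem; rewrite fineK// lexx lu.
split; apply/le_anti; rewrite ?Bl ?Bu /= ?andbT.
  by apply: le_ereal_inf_tmp => _ [y + <-]; rewrite BE => /andP[].
by apply: ge_ereal_sup => _ [y + <-]; rewrite BE => /andP[].
Qed.

(** If every upper end were at least [c], a point above [upper s] and at most [c] would lie in each
    member of [V]: it is to the right of a point of [s], hence of all lower ends. It would then lie
    in [s]. *)
Lemma sup_upper_lt V s (c : \bar R) : supremums V s ->
  (upper s < c)%E <-> exists2 B, V B & (upper B < c)%E.
Proof.
move=> [ubs lubs]; split=> [sc|[B VB]]; last exact/le_lt_trans/upper_mono/ubs.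
apply: contrapT => noB.
have {}noB B : V B -> (c <= upper B)%E.
  by move=> VB; rewrite leNgt; apply/negP => Bc; apply: noB; exists B.
have [[_ _ E]|[l [u [lu sE _ uE]]]] := IR1_cases s.
  by move: sc; rewrite E ltNge leey.
have [r ur rc] : exists2 r : R, u < r & (r%:E <= c)%E.
  rewrite uE in sc; case: c sc {noB} => [c| |] uc //; first by exists c.
  by exists (u + 1); rewrite ?leey// ltrDl.
have /lubs : ubound V (IR_pt (const_mx r)).
  move=> B VB; apply/IR_pt_le/IR1E; rewrite mxE (le_trans rc (noB _ VB)) andbT.
  have /IR_leP/(_ (const_mx u)) := ubs B VB.
  rewrite sE /= mxE lu lexx => /(_ isT)/IR1E/andP[+ _]; rewrite mxE => /le_trans; apply.
  by rewrite lee_fin ltW.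
by move/IR_pt_le; rewrite sE /= mxE [(r <= u)%R]leNgt ur andbF.
Qed.

Lemma sup_lower_gt V s (c : \bar R) : supremums V s ->
  (c < lower s)%E <-> exists2 B, V B & (c < lower B)%E.
Proof.
move=> [ubs lubs]; split=> [sc|[B VB cB]]; last first.
  apply: (lt_le_trans cB); have /IR_leP sB := ubs B VB.
  by apply: ereal_inf_le_tmp; exact: image_subset.
apply: contrapT => noB.
have {}noB B : V B -> (lower B <= c)%E.
  by move=> VB; rewrite leNgt; apply/negP => Bc; apply: noB; exists B.
have [[_ E _]|[l [u [lu sE lE _]]]] := IR1_cases s.
  by move: sc; rewrite E ltNge leNye.
have [r ur rc] : exists2 r : R, r < l & (c <= r%:E)%E.
  rewrite lE in sc; case: c sc {noB} => [c| |] uc //; first by exists c.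
  by exists (l - 1); rewrite ?leNye// gtrBl.
have /lubs : ubound V (IR_pt (const_mx r)).
  move=> B VB; apply/IR_pt_le/IR1E; rewrite mxE (le_trans (noB _ VB) rc)/=.
  have /IR_leP/(_ (const_mx l)) := ubs B VB.
  rewrite sE /= mxE lu lexx => /(_ isT)/IR1E/andP[_]; rewrite mxE; apply: le_trans.
  by rewrite lee_fin ltW.
by move/IR_pt_le; rewrite sE /= mxE [(l <= r)%R]leNgt ur.
Qed.

Lemma IR1_way_below B C : way_below B C <->
  IR_set B = setT \/ (lower B < lower C)%E /\ (upper C < upper B)%E.
Proof.
rewrite IR_way_belowP.
have [[BT _ _]|[a [b [ab BE aE bE]]]] := IR1_cases B.
  by split=> _; [left|rewrite BT interiorT].
have coord : continuous (fun y : 'rV[R]_1 => y ord0 ord0).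
  by move=> y; exact: coord_continuous.
have nT : IR_set B <> setT.
  move=> BT; have : IR_set B (const_mx (b + 1)) by rewrite BT.
  by rewrite BE /= mxE gerDl ler10 andbF.
rewrite aE bE; split=> [CB|[//|[lC uC]] y /IR1E/andP[ly yu]].
  right; have [[CT _ _]|[l [u [lu CE -> ->]]]] := IR1_cases C.
    by case: nT; apply/seteqP; split=> // y _; apply: interior_subset; apply: CB; rewrite CT.
  (* Each endpoint of [C] is interior to [B], so [B] reaches strictly beyond it; half the radius is
     used below because balls are open. *)
  have inner t : l <= t <= u -> exists2 e : R, 0 < e & forall r, `|r - t| < e ->
      a <= r <= b.
    move=> ltu; have /nbhs_ballP[e e0 eB] : nbhs (const_mx t : 'rV[R]_1) (IR_set B).
      by apply: CB; rewrite CE /= mxE.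
    exists e => // r rt; have := eB (const_mx r); rewrite BE /= mxE; apply.
    by split=> // i j; rewrite !mxE /ball /= distrC.
  have [e e0 /(_ (l - e / 2))] := inner l (ltac:(by rewrite lexx lu)).
  have [e' e'0 /(_ (u + e' / 2))] := inner u (ltac:(by rewrite lexx lu)).
  have half (r : R) : 0 < r -> `|r / 2| < r.
    by move=> r0; rewrite gtr0_norm ?divr_gt0// gtr_pMr// invf_lt1// ltr1n.
  rewrite addrAC subrr add0r half// => /(_ isT)/andP[_ h1].
  rewrite addrAC subrr add0r normrN half// => /(_ isT)/andP[h2 _].
  rewrite !lte_fin; split.
    by apply: le_lt_trans h2 _; rewrite gtrBl divr_gt0.
  by apply: lt_le_trans h1; rewrite ltrDl divr_gt0.
have /lt_le_trans/(_ ly) := lC; have /(le_lt_trans yu) := uC; rewrite !lte_fin => yb ay.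
have nearP (P : set R) : open P -> P (y ord0 ord0) ->
    nbhs y [set z : 'rV[R]_1 | P (z ord0 ord0)].
  by move=> oP Py; apply: (coord y P); exact: open_nbhs_nbhs.
apply: filterS (filterI (nearP _ (@open_gt _ a) ay) (nearP _ (@open_lt _ b) yb)).
by move=> z [/ltW az /ltW zb]; rewrite BE /= az zb.
Qed.

End Intervals.

(** * Compact sets, step functions and their maxima *)

Section CompactDomain.
Context {R : realType} {n : nat}.
Local Open Scope ring_scope.
Implicit Types (B C : KR R n) (x : 'rV[R]_n).

Lemma KR_closed C : closed (KR_set C).
Proof.
by case: C => C /= [->|[_ cC]]; [exact: closedT|apply: compact_closed].
Qed.

Lemma KR_pt_subproof x : [set x] = setT \/ ([set x] !=set0 /\ compact [set x]).
Proof. by right; split; [exists x|exact: compact_set1]. Qed.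

Definition KR_pt x : KR R n := MkKR (KR_pt_subproof x).

Lemma KR_pt_le C x : (C <= KR_pt x)%O <-> KR_set C x.
Proof.
by split=> [/KR_leP|Cx]; [exact|apply/KR_leP => _ ->].
Qed.

(** Otherwise the sets [B] minus [U] generate a filter, which clusters in a compact member. The
    cluster point lies in every [B] and outside [U]; its singleton is an upper bound of [A], so the
    point is in [s], contradicting [s] inside [U]. *)
Lemma KR_sup_sub (A : set (KR R n)) (s : KR R n) (U : set 'rV[R]_n) :
  directed A -> supremums A s -> open U -> KR_set s `<=` U ->
  exists2 B, A B & KR_set B `<=` U.
Proof.
move=> [[B0 AB0] dA] [ubs lubs] oU sU; apply: contrapT => noB.
have rest B : A B -> (KR_set B `\` U) !=set0.
  move=> AB; apply/set0P/eqP => BU; apply: noB; exists B => //.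
  by rewrite -setD_eq0.
(* If every member were bottom, [s] would be the whole space and so would [U]. *)
have [B1 AB1 cB1] : exists2 B, A B & compact (KR_set B).
  apply: contrapT => nocpt.
  have sbot : (s <= KR_bot)%O.
    apply: lubs => B AB; have [BT|[_ cB]] := KRP B; last by case: nocpt; exists B.
    by apply/KR_leP; rewrite BT.
  have [x [_]] := rest _ AB0; apply; apply: sU.
  by move/KR_leP : sbot; apply.
pose F := filter_from A (fun B => KR_set B `\` U).
have FF : ProperFilter F.
  apply: filter_from_proper => //; apply: filter_from_filter; first by exists B0.
  move=> B C AB AC; have [D [AD /KR_leP DB /KR_leP DC]] := dA _ _ AB AC.
  by exists D => // x [Dx Ux]; split; split=> //; [exact: DB|exact: DC].
have [|x [B1x Fx]] := cB1 F FF; first by exists B1 => // x [].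
have clx B : A B -> (KR_set B `\` U) x.
  move=> AB; have cl : closed (KR_set B `\` U).
    by apply: closedI; [exact: KR_closed|exact: open_closedC].
  by apply: cl => N Nx; apply: Fx => //; exists B.
have /KR_pt_le sx : (s <= KR_pt x)%O.
  by apply: lubs => B AB; apply/KR_pt_le; have [] := clx B AB.
by have [_] := clx _ AB0; apply; exact: sU.
Qed.

Definition cube (e : R) : set 'rV[R]_n := box (const_mx (- e)) (const_mx e).

Lemma cubeP e x : cube e x <-> forall i : 'I_n, `|x ord0 i| <= e.
Proof. by split=> h i; have := h i; rewrite ?mxE -ler_norml ?mxE. Qed.

(** Minkowski sum with a closed cube: a compact neighbourhood of a compact [K] when [e] is
    positive. *)
Definition swell (K : set 'rV[R]_n) (e : R) :=
  [set x.1 + x.2 | x in K `*` cube e].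

Lemma swell_compact K e : compact K -> compact (swell K e).
Proof.
move=> cK; apply: continuous_compact; last first.
  by apply: compact_setX => //; exact: box_compact.
by apply: continuous_subspaceT => x; exact: add_continuous.
Qed.

Lemma sub_swell K e : 0 <= e -> K `<=` swell K e.
Proof.
move=> e0 x Kx; exists (x, 0); last by rewrite /= addr0.
by split=> //; apply/cubeP => i; rewrite mxE normr0.
Qed.

Lemma swell_ball K e x y : K x -> ball x e y -> swell K e y.
Proof.
move=> Kx [_ xy]; exists (x, y - x); last by rewrite /= addrC subrK.
split=> //; apply/cubeP => i; have := xy ord0 i.
by rewrite /ball /= !mxE distrC => /ltW.
Qed.

Lemma swell_sub K e e' : e <= e' -> swell K e `<=` swell K e'.
Proof.
move=> ee _ [[x t] [/= Kx /cubeP te] <-]; exists (x, t) => //; split=> //.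
by apply/cubeP => i; exact: le_trans (te i) ee.
Qed.

Lemma KR_way_belowP B C : way_below B C <-> KR_set C `<=` (KR_set B)°.
Proof.
split=> [BC|CB A s dA As /KR_leP Cs]; last first.
  have [|D AD Dsub] := KR_sup_sub dA As (@open_interior _ (KR_set B)).
    exact: subset_trans CB.
  exists D => //; apply/KR_leP; apply: subset_trans Dsub _.
  exact: interior_subset.
have [CT|[[c Cc] cC]] := KRP C.
  have dbot : directed [set (KR_bot : KR R n)].
    by split=> [|x y -> ->]; [exists KR_bot|exists KR_bot].
  have sbot : supremums [set (KR_bot : KR R n)] KR_bot by rewrite supremums1.
  have Cbot : (C <= KR_bot)%O by apply/KR_leP; rewrite CT.
  have [_ -> /KR_leP BT] := BC _ _ dbot sbot Cbot.
  have -> : KR_set B = setT by apply/seteqP; split.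
  by rewrite interiorT.
pose A := [set D : KR R n | exists2 e, 0 < e & KR_set D = swell (KR_set C) e].
have AE e : 0 < e -> exists2 D, A D & KR_set D = swell (KR_set C) e.
  move=> e0; have KRD : swell (KR_set C) e = setT \/
      (swell (KR_set C) e !=set0 /\ compact (swell (KR_set C) e)).
    right; split; last exact: swell_compact.
    by exists c; apply: sub_swell => //; exact: ltW.
  by exists (MkKR KRD) => //; exists e.
have dA : directed A.
  split; first by have [D AD _] := AE 1 ltr01; exists D.
  move=> D D' [e e0 De] [e' e'0 De'].
  have m0 : 0 < Num.min e e' by rewrite lt_min e0 e'0.
  have [D'' AD'' D''E] := AE _ m0; exists D''; split=> //; apply/KR_leP.
    by rewrite D''E De; apply: swell_sub; rewrite ge_min lexx.
  by rewrite D''E De'; apply: swell_sub; rewrite ge_min lexx orbT.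
have As : supremums A C.
  split=> [D [e e0 DE]|D ubD].
    by apply/KR_leP; rewrite DE; apply: sub_swell; exact: ltW.
  apply/KR_leP => x Dx; apply: (KR_closed (C := C)) => N /nbhs_ballP[e e0 eN].
  (* Cubes are closed and balls open, hence the halved radius. *)
  have [D' AD' D'E] := AE (e / 2) (ltac:(by rewrite divr_gt0)).
  have /KR_leP/(_ _ Dx) := ubD _ AD'; rewrite D'E => -[[y t] [/= Cy /cubeP te] yx].
  exists y; split=> //; apply: eN; split=> // i j.
  rewrite /ball /= -yx (ord1 i) !mxE addrAC subrr add0r.
  by apply: le_lt_trans (te j) _; rewrite gtr_pMr// invf_lt1// ltr1n.
have [D [e e0 DE] /KR_leP DB] := BC _ _ dA As (lexx _).
move=> x Cx; apply/nbhs_ballP; exists e => // y xy.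
by apply: DB; rewrite DE; apply: swell_ball xy.
Qed.

End CompactDomain.

(** * Values of step functions and their maxima *)

Section StepFunctions.
Context {R : realType} {n : nat}.
Implicit Types (S : set (scott_map (IR R n) (IR R 1))).

(** Besides existence, this records that the supremum is computed pointwise, which gives access to
    the values of [fun_enum]. *)
Lemma pointwise_sup S :
  (forall x, ubound [set scott_fun f x | f in S] !=set0) ->
  exists g, supremums S g /\
    forall x, supremums [set scott_fun f x | f in S] (scott_fun g x).
Proof.
move=> ubS; pose V x := [set scott_fun f x | f in S].
have /choice[g gP] x : exists s, supremums (V x) s.
  by have [c ubc] := ubS x; exact: IR1_sup ubc.
have Vg f x : S f -> (f x <= g x)%O by move=> Sf; apply: (gP x).1; exists f.
have gmono x y : (x <= y)%O -> (g x <= g y)%O.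
  move=> xy; apply: (gP x).2 => _ [f Sf <-].
  exact: le_trans (scott_mono (@scottP _ _ _ _ f) xy) (Vg _ _ Sf).
have gs : scott_continuous g.
  move=> A s dA As; split=> [_ [x Ax <-]|c ubc]; first exact/gmono/As.1.
  apply: (gP s).2 => _ [f Sf <-].
  apply: (@scottP _ _ _ _ f _ _ dA As).2 => _ [x Ax <-].
  by apply: le_trans (Vg _ _ Sf) _; apply: ubc; exists x.
exists (ScottMap gs); split=> //.
split=> [f Sf|h ubh]; apply/asboolP => x /=; first exact: Vg.
by apply: (gP x).2 => _ [f Sf <-]; have /asboolP := ubh f Sf; apply.
Qed.

Definition step_dom p : IR R n := IR_enum n (entry p 0).
Definition step_val p : IR R 1 := IR_enum 1 (entry p 1).

Definition bounded_steps j := forall x : 'rV[R]_n, exists y : 'rV[R]_1,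
  forall p, p \in CodeSeq.decode j -> (IR_set (step_dom p))° x -> IR_set (step_val p) y.

(** With [bounded_steps] built in, an unbounded list has no active step, and the supremum of the
    empty set is the bottom value that [fun_enum] then takes. *)
Definition active j (x : 'rV[R]_n) : set nat := [set p |
  [/\ p \in CodeSeq.decode j, bounded_steps j & (IR_set (step_dom p))° x]].

Lemma step_in p (z : IR R n) : way_below (step_dom p) z ->
  single_step_enum n p z = step_val p :> IR R 1.
Proof. by move=> h; rewrite /single_step_enum /= /step_fun; case: pselect. Qed.

Lemma step_out p (z : IR R n) : ~ way_below (step_dom p) z ->
  single_step_enum n p z = IR_bot :> IR R 1.
Proof. by move=> h; rewrite /single_step_enum /= /step_fun; case: pselect. Qed.

Lemma way_below_pt (d : IR R n) x : way_below d (IR_pt x) <-> (IR_set d)° x.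
Proof. by rewrite IR_way_belowP IR_ptE; split=> [|h _ ->]; [exact|]. Qed.

Lemma fun_enum_pt j x :
  supremums [set step_val p | p in active j x] (fun_enum n j (IR_pt x)).
Proof.
pose S := [set @single_step_enum R n p | p in [set` CodeSeq.decode j]].
have [bj|nbj] := pselect (bounded_steps j); last first.
  (* The value of a supremum at a point would contain a common element of the active steps there. *)
  have noS h : ~ supremums S h.
    move=> Sh; apply: nbj => y; have [z hz] := IR_nonempty (h (IR_pt y)).
    exists z => p pj py; have /asboolP/(_ (IR_pt y)) : (single_step_enum n p <= h)%O.
      by apply: Sh.1; exists p.
    by rewrite step_in; [move/IR_leP; apply|exact/way_below_pt].
  have -> : fun_enum n j = scott_bot :> scott_map (IR R n) (IR R 1).
    rewrite /fun_enum /supremum; case: ifP => // _.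
    by case: xgetP => // h _ Sh; case: (noS h).
  by split=> [_ [p [_ /nbj]]//|c _]; exact: IR_bot_le.
have ubS z : ubound [set scott_fun f z | f in S] !=set0.
  (* Any step whose domain is way below [z] is active at each point [y] of [z], so a bound at [y]
     also serves at [z]. *)
  have [y zy] := IR_nonempty z; have [w wP] := bj y.
  exists (IR_pt w) => _ [_ [p pj <-] <-].
  have [pz|npz] := pselect (way_below (step_dom p) z).
    rewrite step_in//; apply/IR_pt_le; apply: wP => //.
    by move/IR_way_belowP : pz; apply.
  by rewrite step_out//; exact: IR_bot_le.
have [g [gS gP]] := pointwise_sup ubS; rewrite /fun_enum (supremum_botE gS).
have [ubg lubg] := gP (IR_pt x); split=> [_ [p [pj _ px] <-]|c ubc].
  apply: ubg; exists (single_step_enum n p); first by exists p.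
  by rewrite step_in//; exact/way_below_pt.
apply: lubg => _ [_ [p pj <-] <-].
have [px|npx] := pselect (way_below (step_dom p) (IR_pt x)).
  by rewrite step_in//; apply: ubc; exists p => //; split=> //; exact/way_below_pt.
by rewrite step_out//; exact: IR_bot_le.
Qed.

Lemma upper_fun_lt j x (c : \bar R) : (upper (fun_enum n j (IR_pt x)) < c)%E <->
  exists2 p, active j x p & (upper (step_val p) < c)%E.
Proof.
rewrite (sup_upper_lt _ (fun_enum_pt j x)).
by split=> [[_ [p pj <-] pc]|[p pj pc]]; [exists p|exists (step_val p) => //; exists p].
Qed.

Lemma lower_fun_gt j x (c : \bar R) : (c < lower (fun_enum n j (IR_pt x)))%E <->
  exists2 p, active j x p & (c < lower (step_val p))%E.
Proof.
rewrite (sup_lower_gt _ (fun_enum_pt j x)).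
by split=> [[_ [p pj <-] pc]|[p pj pc]]; [exists p|exists (step_val p) => //; exists p].
Qed.

Variable X : compacts R n.

Lemma max_lower_gt j (c : \bar R) : (c < max_lower (fun_enum n j) X)%E <->
  exists x p, [/\ compacts_set X x, active j x p & (c < lower (step_val p))%E].
Proof.
split=> [/ereal_sup_gt[_ [x Xx <-] /lower_fun_gt[p xp cp]]|[x [p [Xx xp cp]]]].
  by exists x, p.
apply: lt_le_trans (max_lowerP _ Xx); apply/lower_fun_gt; by exists p.
Qed.

Lemma max_upper_lt j (c : \bar R) : (max_upper (fun_enum n j) X < c)%E <->
  forall x, compacts_set X x ->
    exists2 p, active j x p & (upper (step_val p) < c)%E.
Proof.
split=> [Xc x Xx|h].
  by apply/upper_fun_lt; apply: le_lt_trans Xc; exact: max_upperP.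
(* A strict bound at every point need not pass to a supremum; here [m] is the largest of finitely
   many step values below [c]. *)
pose m := \big[Order.max/-oo%E]_(p <- CodeSeq.decode j |
  (upper (step_val p) < c)%E) upper (step_val p).
apply: (@le_lt_trans _ _ m).
  apply: ge_ereal_sup => _ [x Xx <-]; have [p pj pc] := h x Xx.
  apply: (@bigmax_sup_seq _ _ _ _ _ p) => //; first by case: pj.
  by apply: upper_mono; apply: (fun_enum_pt j x).1; exists p.
(* The initial value -oo must be below [c] as well, which any point of [X] guarantees. *)
apply: bigmax_lt => //; have [[x Xx] _] := compactsP X.
have [p _ pc] := h x Xx; exact: le_lt_trans (leNye _) pc.
Qed.

Lemma way_below_maxV (B : IR R 1) f : way_below B (maxV X f) <->
  IR_set B = setT \/ (lower B < max_lower f X)%E /\ (max_upper f X < upper B)%E.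
Proof.
have lu := max_lower_le_upper f X.
rewrite IR1_way_below; have [fT|fT] := eqVneq (max_upper f X) +oo%E.
  have -> : maxV X f = IR_bot by apply: IR_eq; rewrite /= /maxV_set fT eqxx.
  have -> : upper (@IR_bot R 1) = +oo%E.
    have [[]//|[l [u [_ E _ _]]]] := IR1_cases (@IR_bot R 1).
    have : IR_set (@IR_bot R 1) (const_mx (u + 1)%R) by [].
    by rewrite E /= mxE gerDl ler10 andbF.
  by rewrite fT !ltNge !leey; split=> -[|[]//]; left.
have [[x Xx] _] := compactsP X.
have [lx ux] := (max_lowerP f Xx, max_upperP f Xx).
(* As [max_upper] is not +oo, the value at [x] is a bounded interval, and this makes both maxima
   finite. *)
have [[_ _ E]|[l [u [_ _ lE uE]]]] := IR1_cases (f (IR_pt x)).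
  by move: ux fT; rewrite E leye_eq => ->.
rewrite lE in lx; rewrite uE in ux.
have ufin : max_upper f X \is a fin_num.
  by rewrite fin_numE fT andbT -ltNye (lt_le_trans (ltNyr _) ux).
have lfin : max_lower f X \is a fin_num.
  rewrite fin_numE -ltNye (lt_le_trans (ltNyr _) lx)/= -ltey.
  by rewrite (le_lt_trans lu)// ltey.
have [|-> -> //] := @lower_upper_itv _ (maxV X f) _ _ lu lfin ufin.
by rewrite /= /maxV_set (negbTE fT).
Qed.

Lemma way_below_maxS (B : KR R n) f : way_below B (maxS X f) <->
  forall x, compacts_set X x -> (KR_set B)° x \/
    (upper (f (IR_pt x)) < max_lower f X)%E.
Proof.
rewrite KR_way_belowP /= maxS_setE; split=> [h x Xx|h x [Xx /= fx]].
  by have [fx|] := leP (max_lower f X) (upper (f (IR_pt x))); [left; apply: h|right].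
by have [//|] := h x Xx; rewrite ltNge fx.
Qed.

End StepFunctions.

(** * Correctness of the decision procedures *)

Section Decision.
Context {R : realType}.
Local Open Scope ring_scope.

Lemma lower_upper_bot :
  lower (@IR_bot R 1) = -oo%E /\ upper (@IR_bot R 1) = +oo%E.
Proof.
have [[]//|[l [u [_ E _ _]]]] := IR1_cases (@IR_bot R 1).
have : IR_set (@IR_bot R 1) (const_mx (u + 1)) by [].
by rewrite E /= mxE gerDl ler10 andbF.
Qed.

Lemma lower_upper_rat_box k : lower (@rat_box R 1 k) = (grid (lo k 0))%:E /\
  upper (@rat_box R 1 k) = (grid (hi k 0))%:E.
Proof.
apply: lower_upper_itv => //.
  rewrite lee_fin /grid ler_rat.
  by have := @corner_le 1 k ord0; rewrite corner_minE corner_maxE.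
apply/seteqP; split=> y /=; rewrite !lee_fin.
  by move/rat_boxP => /(_ ord0).
by move=> h; apply/rat_boxP => i; rewrite (ord1 i).
Qed.

Lemma lower_ltP v v' :
  (lower (@IR_enum R 1 v) < lower (@IR_enum R 1 v'))%E = lower_lt v v'.
Proof.
rewrite /lower_lt; case: v' => [|v'] /=.
  by rewrite (lower_upper_bot).1 ltNge leNye.
rewrite (lower_upper_rat_box v').1; case: v => [|v] /=.
  by rewrite (lower_upper_bot).1 ltNyr.
by rewrite (lower_upper_rat_box v).1 lte_fin grid_lt.
Qed.

Lemma upper_ltP v v' :
  (upper (@IR_enum R 1 v) < upper (@IR_enum R 1 v'))%E = upper_lt v v'.
Proof.
rewrite /upper_lt; case: v => [|v] /=.
  by rewrite (lower_upper_bot).2 ltNge leey.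
rewrite (lower_upper_rat_box v).2; case: v' => [|v'] /=.
  by rewrite (lower_upper_bot).2 ltry.
by rewrite (lower_upper_rat_box v').2 lte_fin grid_lt.
Qed.

Lemma upper_lt_lowerP v v' :
  (upper (@IR_enum R 1 v) < lower (@IR_enum R 1 v'))%E = upper_lt_lower v v'.
Proof.
rewrite /upper_lt_lower; case: v => [|v] /=.
  by rewrite (lower_upper_bot).2 ltNge leey.
rewrite (lower_upper_rat_box v).2; case: v' => [|v'] /=.
  by rewrite (lower_upper_bot).1 ltNge leNye.
by rewrite (lower_upper_rat_box v').1 lte_fin grid_lt.
Qed.

Section Test.
Variables (n N b : nat).
Hypothesis adq : adequate N b.

Lemma step_le p s j :
  p \in CodeSeq.decode j -> (j <= N)%N -> (entry p s <= N)%N.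
Proof.
by move=> pj; apply: leq_trans; apply: leq_trans (entry_le _ _) (decode_le pj).
Qed.

Lemma grid_set_dom j p : (j <= N)%N -> p \in CodeSeq.decode j ->
  grid_set N (IR_set (@step_dom R n p))°.
Proof. by move=> jN pj; apply: grid_set_interior; apply/grid_set_IR/(step_le _ pj). Qed.

Lemma consistentP j : (j <= N)%N -> @bounded_steps R n j <-> consistent n N b j.
Proof.
move=> jN; pose K := [set x : 'rV[R]_n | exists y : 'rV[R]_1, forall p,
  p \in CodeSeq.decode j -> (IR_set (step_dom p))° x -> IR_set (step_val p) y].
have gK : grid_set N K.
  move=> x x' xx [y yP]; exists y => p pj px; apply: yP => //.
  exact: (grid_set_dom jN pj) (same_cellC xx) px.
have testK z : K (pt z) <-> has_lt (bound 1 b) (fun y => all_in j (fun p =>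
    int_IR n N (bound n b) (entry p 0) z ==> in_IR 1 (entry p 1) y)).
  rewrite /K /= (@ex_test R 1 N b [set y | forall p, p \in CodeSeq.decode j ->
    (IR_set (step_dom p))° (pt z) -> IR_set (step_val p) y] adq); last first.
    move=> y y' yy h p pj px; have := h p pj px.
    exact: (grid_set_IR (step_le 1 pj jN)).
  split=> [[y yb h]|/has_ltP[y yb]].
    apply/has_ltP; exists y => //; rewrite all_inE; apply/allP => p pj.
    apply/implyP => /(int_IRP (R := R) z adq (step_le 0 pj jN)) /(h p pj).
    by move/in_IRP.
  rewrite all_inE => /allP h; exists y => // p pj px; apply/in_IRP.
  by apply: (implyP (h p pj)); apply/(int_IRP (R := R) z adq (step_le 0 pj jN)).
rewrite /bounded_steps -/(forall x, K x) (all_test adq gK).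
by split=> [h|/all_ltP h z /h/testK//]; apply/all_ltP => z /h/testK.
Qed.

Lemma meets_decP kX u : (kX <= N)%N -> (u <= N)%N ->
  (exists x : 'rV[R]_n, boxes kX x /\ (IR_set (IR_enum n u))° x) <->
  meets_dec n N b kX u.
Proof.
move=> kN uN.
rewrite (@ex_test R n N b (boxes kX `&` (IR_set (IR_enum n u))°) adq); last first.
  move=> x y xy [xX xu]; split; first exact: (grid_set_boxes kN xy).
  exact: (grid_set_interior (grid_set_IR uN) xy).
split=> [[z zb [/(in_boxesP (R := R)) zX /(int_IRP (R := R) z adq uN) zu]]|/has_ltP[z zb]].
  by apply/has_ltP; exists z => //; rewrite zX.
by move=> /andP[/(in_boxesP (R := R)) zX /(int_IRP (R := R) z adq uN) zu]; exists z.
Qed.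

Variables (kX j : nat) (X : compacts R n).
Hypotheses (kN : (kX <= N)%N) (jN : (j <= N)%N).
Hypothesis XE : compacts_set X = boxes kX.

Lemma activeP (x : 'rV[R]_n) p : active j x p <->
  [/\ consistent n N b j, p \in CodeSeq.decode j & (IR_set (step_dom p))° x].
Proof.
by have cP := consistentP jN; split=> -[h1 h2 h3]; split=> //; exact/cP.
Qed.

Lemma max_lower_gt_test (c : \bar R) :
  (c < max_lower (fun_enum n j) X)%E <-> consistent n N b j /\
    exists2 p, p \in CodeSeq.decode j &
      (c < lower (@step_val R p))%E /\ meets_dec n N b kX (entry p 0).
Proof.
rewrite max_lower_gt; split=> [[x [p [Xx /activeP[cj pj px] cp]]]|].
  split=> //; exists p => //; split=> //.
  by apply/(meets_decP kN (step_le 0 pj jN)); exists x; rewrite -XE.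
move=> [cj [p pj [cp /(meets_decP kN (step_le 0 pj jN))[x [xX px]]]]].
by exists x, p; split; rewrite ?XE//; apply/activeP.
Qed.

Lemma maxV_decP i : (i <= N)%N ->
  way_below (IR_enum 1 i) (maxV X (fun_enum n j)) <-> maxV_dec n N b kX i j.
Proof.
move=> iN; rewrite way_below_maxV /maxV_dec.
have [->|i0] := eqVneq i 0%N; first by split=> // _; left.
have notT : IR_set (@IR_enum R 1 i) <> setT.
  case: i i0 {iN} => // i _ E.
  have EB : rat_box 1 i = IR_bot :> IR R 1 by exact: IR_eq.
  by have := (@lower_upper_rat_box i).1; rewrite EB (lower_upper_bot).1.
rewrite max_lower_gt_test max_upper_lt; split.
  case=> [//|[[cj [q qj [lq mq]]] h]]; apply/and3P; split=> //.
    by rewrite has_inE; apply/hasP; exists q => //; rewrite -lower_ltP lq.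
  apply/all_ltP => z zb; apply/implyP => /(in_boxesP (R := R)) zX.
  have [p /activeP[_ pj pz] pc] := h (pt z) (ltac:(by rewrite XE)).
  rewrite has_inE; apply/hasP; exists p => //; rewrite -upper_ltP pc.
  by apply/(int_IRP (R := R) z adq (step_le 0 pj jN)).
move=> /and3P[cj]; rewrite has_inE => /hasP[q qj /andP[lq mq]] /all_ltP h.
right; split; first by split=> //; exists q => //; rewrite lower_ltP.
pose K := [set x : 'rV[R]_n | boxes kX x -> exists2 p, active j x p &
  (upper (@step_val R p) < upper (@IR_enum R 1 i))%E].
suff : forall x, K x by move=> KT x; rewrite XE; exact: KT.
apply/(all_test (N := N) adq) => [x y xy Kx yX|z zb /(in_boxesP (R := R)) zX].
  have [|p /activeP[_ pj px] pc] := Kx _.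
    exact: (grid_set_boxes kN (same_cellC xy)).
  by exists p => //; apply/activeP; split=> //; exact: (grid_set_dom jN pj xy).
have := implyP (h z zb) zX; rewrite has_inE => /hasP[p pj /andP[pc]].
move=> /(int_IRP (R := R) z adq (step_le 0 pj jN)) pz.
by exists p; [apply/activeP|rewrite upper_ltP].
Qed.

Lemma upper_lt_max_lower_test (x : 'rV[R]_n) :
  (upper (fun_enum n j (IR_pt x)) < max_lower (fun_enum n j) X)%E <->
  consistent n N b j /\ exists2 p, p \in CodeSeq.decode j &
    (IR_set (step_dom p))° x /\ has_in j (fun q =>
      upper_lt_lower (entry p 1) (entry q 1) && meets_dec n N b kX (entry q 0)).
Proof.
rewrite upper_fun_lt; split=> [[p /activeP[cj pj px]]|].
  move=> /max_lower_gt_test[_ [q qj [pq mq]]]; split=> //; exists p => //.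
  by split=> //; rewrite has_inE; apply/hasP; exists q => //; rewrite -(upper_lt_lowerP) pq.
move=> [cj [p pj [px]]]; rewrite has_inE => /hasP[q qj /andP[pq mq]].
exists p; first exact/activeP.
by apply/max_lower_gt_test; split=> //; exists q => //; rewrite upper_lt_lowerP.
Qed.

Lemma maxS_decP i : (i <= N)%N ->
  way_below (KR_enum n i) (maxS X (fun_enum n j)) <-> maxS_dec n N b kX i j.
Proof.
move=> iN; rewrite way_below_maxS /maxS_dec.
have [->|i0] := eqVneq i 0%N.
  by split=> // _ x _; left; rewrite /= KR_enum_setE interiorT.
(* Membership in [X] becomes a premise, so that the condition ranges over all points and is a union
   of cells. *)
pose K := [set x : 'rV[R]_n | boxes kX x -> (KR_set (KR_enum n i))° x \/
  (upper (fun_enum n j (IR_pt x)) < max_lower (fun_enum n j) X)%E].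
have gK : grid_set N K.
  move=> x y xy Kx yX; have [||/upper_lt_max_lower_test[cj [p pj [px pq]]]] := Kx _.
  - exact: (grid_set_boxes kN (same_cellC xy)).
  - by move=> xK; left; exact: (grid_set_interior (grid_set_KR iN) xy).
  - right; apply/upper_lt_max_lower_test; split=> //; exists p => //; split=> //.
    exact: (grid_set_dom jN pj xy).
have -> : (forall x, compacts_set X x -> (KR_set (KR_enum n i))° x \/
  (upper (fun_enum n j (IR_pt x)) < max_lower (fun_enum n j) X)%E) = forall x, K x.
  by rewrite XE.
rewrite (all_test adq gK); split=> [h|/all_ltP h z zb /(in_boxesP (R := R)) zX].
  apply/all_ltP => z zb; apply/implyP => /(in_boxesP (R := R)) zX; apply/orP.
  have [/(int_KRP (R := R) z adq iN)|/upper_lt_max_lower_test] := h z zb zX.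
    by left.
  move=> [cj [p pj [pz pq]]]; right; rewrite cj has_inE; apply/hasP; exists p => //.
  by rewrite pq andbT; apply/(int_IRP (R := R) z adq (step_le 0 pj jN)).
have /orP[/(int_KRP (R := R) z adq iN)|/andP[cj]] := implyP (h z zb) zX; first by left.
rewrite has_inE => /hasP[p pj /andP[/(int_IRP (R := R) z adq (step_le 0 pj jN)) pz pq]].
by right; apply/upper_lt_max_lower_test; split=> //; exists p.
Qed.

End Test.

Lemma rat_box_union_code n (K : set 'rV[R]_n) : rat_box_union K ->
  exists kX, K = boxes kX.
Proof.
move=> [m [B [/= Brat ->]]].
have /choice[g gP] : forall i, exists k, IR_set (rat_box n k) = B i.
  by move=> i; apply/rat_box_surj.
exists (CodeSeq.code [seq g i | i <- enum 'I_m.+1]); rewrite /boxes CodeSeq.codeK.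
apply/seteqP; split=> x.
  move=> [i _ xi]; exists (g i); last by rewrite gP.
  by apply/mapP; exists i => //; rewrite mem_enum.
by move=> [k /mapP[i _ ->{k}]]; rewrite gP => xi; exists i.
Qed.

End Decision.

Theorem theorem4p16 (R : realType) (n : nat) (X : compacts R n)
    (hX : rat_box_union (compacts_set X)) :
  computable (fun_enum n) (IR_enum 1) (maxV X) /\
  computable (fun_enum n) (KR_enum n) (maxS X).
Proof.
have [kX XE] := rat_box_union_code hX.
(* One grid bound dominates all three codes, and with them every code nested inside. *)
have le_sum i j : [/\ i <= i + j + kX, j <= i + j + kX & kX <= i + j + kX].
  by rewrite leq_addl -addnA leq_addr addnCA leq_addr.
split.
  apply: (enumerable_of_adequate (kX := kX) (@rec_maxV_dec n) adequate_exists).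
  by move=> i j b adq; have [iN jN kN] := le_sum i j; exact: maxV_decP.
apply: (enumerable_of_adequate (kX := kX) (@rec_maxS_dec n) adequate_exists).
by move=> i j b adq; have [iN jN kN] := le_sum i j; exact: maxS_decP.
Qed.
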